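(* Let $\rho^0,\rho^1$ be probability densities on $\Omega=[0,1]^d$, let $L=1+\log_2(1/h)$ be an integer, and let $h_l=2^{L-l}h$ for $l=1,\dots,L$ (so $h_1=1$, $h_L=h$). Assume: (i) the saddle-point sets $Y^*_{h_l}$ are nonempty for all $l=1,\dots,L$, and there is a constant $C_3$ independent of $h_l$ such that $\|y^*_{h_l}\|_{L^2}^2\le C_3$ for every $y^*_{h_l}\in Y^*_{h_l}$, $l=1,\dots,L$; (ii) there are constants $C_4>0$ (independent of $h_l$) and $\nu>0$ such that for every $l=1,\dots,L-1$ and every $y^*_{h_l}\in Y^*_{h_l}$ there is $y^*_{h_{l+1}}\in Y^*_{h_{l+1}}$ with $\|\mathrm{Interpolate}(y^*_{h_l})-y^*_{h_{l+1}}\|_{L^2}^2\le C_4(h_l)^\nu$. Suppose both Algorithm 2 and Algorithm 2M are started from the zero initialization. Then: 1. If $\varepsilon\in\mathcal T_2$, the complexity of Algorithm 2 on the grid of step $h$ with tolerance $\varepsilon$ is $$\mathcal O_2=O\Big(\frac1\varepsilon\,\frac{d}{h^{d}}\log\frac1h\Big).$$ 2. If $\{\varepsilon_l\}_{l=1}^L\in\mathcal T_{2M}$ and $\varepsilon_l=\varepsilon_L\,(h_l/h)^{\alpha}$ for $l=1,\dots,L$ with some fixed $\alpha\in\mathbb R$, the complexity of Algorithm 2M is $$\mathcal O_{2M}=\begin{cases}O\Big(\frac1{\varepsilon_L}\frac{d}{h^{d-\nu}}\log\frac1h\Big)+O\Big(\frac{d2^d}{h^d}\Big),&\alpha>\nu-d,\\[1mm]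 O\Big(\frac1{\varepsilon_L}\frac{d}{h^{d-\nu}}\log^2\frac1h\Big)+O\Big(\frac{d2^d}{h^d}\Big),&\alpha=\nu-d,\\[1mm] O\Big(\frac1{\varepsilon_L}\frac{d}{h^{-\alpha}}\log\frac1h\Big)+O\Big(\frac{d2^d}{h^d}\Big),&\alpha<\nu-d.\end{cases}$$
   Context: Grids and operators. $d\ge1$ is an integer, $1\le p\le\infty$. For $h>0$ with $N=1/h$ an integer, $\Omega^h=\{0,h,2h,\dots,1\}^d$. Put $\rho_h(x)=\rho^0(x)-\rho^1(x)$, $x\in\Omega^h$. For $m_h:\Omega^h\to\mathbb R^d$ with components $m_{h,i}$, $(A_hm_h)(x)=\sum_{i=1}^dD_{h,i}m_h(x)$, where, with $e_i$ the $i$-th unit vector, $D_{h,i}m_h(x)$ equals $m_{h,i}(x)/h$ if $x_i=0$; $(m_{h,i}(x)-m_{h,i}(x-he_i))/h$ if $0<x_i<1$; $-m_{h,i}(x-he_i)/h$ if $x_i=1$. Let $f(m_h)=\sum_{x\in\Omega^h}\|m_h(x)\|_p h^d$. For $u,v:\Omega^h\to\mathbb R^d$, $\langle u,v\rangle_h=\sum_xu(x)\cdot v(x)h^d$ and $\|u\|_{L^2}^2=\langle u,u\rangle_h$. For $y_h=(m_h,\varphi_h)$, $\|y_h\|_{L^2}^2=\|m_h\|_{L^2}^2+\|\varphi_h\|_{L^2}^2$. Saddle problem. Let $f^*(\varphi_h)=\sup_{u_h}\langle\varphi_h,u_h\rangle_h-f(u_h)$, let $\delta_{A_hm_h=\rho_h}(m_h)$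 be $0$ if $A_hm_h=\rho_h$ and $+\infty$ otherwise, and $\tilde L(m_h,\varphi_h)=\delta_{A_hm_h=\rho_h}(m_h)-f^*(\varphi_h)+\langle\varphi_h,m_h\rangle_h$ for $m_h,\varphi_h:\Omega^h\to\mathbb R^d$. $Y_h^*$ is the set of saddle points (min over $m_h$, max over $\varphi_h$) of $\tilde L$. Algorithm 2 (inputs: $h$, initial $(m_h^0,\varphi_h^0)$, tolerance $\varepsilon>0$). With $\mu=\tau=1/2$ and $\bar\varphi_h^0=\varphi_h^0$, iterate $m_h^{k+1}=\arg\min_{m_h}\tilde L(m_h,\bar\varphi_h^k)+\frac1{2\mu}\|m_h-m_h^k\|_{L^2}^2$, $\varphi_h^{k+1}=\arg\max_{\varphi_h}\tilde L(m_h^{k+1},\varphi_h)-\frac1{2\tau}\|\varphi_h-\varphi_h^k\|_{L^2}^2$, $\bar\varphi_h^{k+1}=2\varphi_h^{k+1}-\varphi_h^k$. Let $G_h^k=\frac1\mu\|m_h^{k+1}-m_h^k\|_{L^2}^2+\frac1\tau\|\varphi_h^{k+1}-\varphi_h^k\|_{L^2}^2+2\langle\varphi_h^{k+1}-\varphi_h^k,m_h^{k+1}-m_h^k\rangle_h$. The number of iterations $K$ is the first $k\ge0$ with $G_h^k<\varepsilon$, and the output is $y_h^K=(m_h^K,\varphi_h^K)$. Interpolation from $\Omega^{h_{l-1}}$ to $\Omega^{h_l}$ ($h_{l-1}=2h_l$). For $x\in\Omega^{h_l}$ let $J$ be the set of $j$ with $x_j\in\{0,h_{l-1},2h_{l-1},\dots,1\}$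 and $\hat J$ its complement in $\{1,\dots,d\}$. Let $\mathcal N(x)=\{y\in\Omega^{h_{l-1}}:y_j=x_j\ \forall j\in J,\ |y_j-x_j|\le h_l\ \forall j\in\hat J\}$, and for $i\in\hat J$ let $\hat{\mathcal N}_i(x)=\{y\in\mathcal N(x):y_i=x_i-h_l\}$. For $m:\Omega^{h_{l-1}}\to\mathbb R^d$, the $i$-th component of $\mathrm{Interpolate}(m)(x)$ is the average of $m_i$ over $\mathcal N(x)$ if $i\in J$ and over $\hat{\mathcal N}_i(x)$ if $i\in\hat J$; $\varphi$ is interpolated in the same way, and $\mathrm{Interpolate}(m,\varphi)=(\mathrm{Interpolate}(m),\mathrm{Interpolate}(\varphi))$. Algorithm 2M (inputs: $h$, $L$, tolerances $\{\varepsilon_l\}_{l=1}^L$). For $l=1,\dots,L$ run Algorithm 2 on the grid of step $h_l$ with tolerance $\varepsilon_l$, started at $0$ if $l=1$ and at $\mathrm{Interpolate}(y^{K_{l-1}}_{h_{l-1}})$ if $l\ge2$; $K_l$ is the number of iterations and $y^{K_l}_{h_l}$ the output at level $l$. Tolerance sets. $\mathcal T_2=\{\varepsilon>0:\varepsilon\le\tilde\varepsilon\}$, where $\tilde\varepsilon>0$ is a threshold such that Algorithm 2 (from zero) run with any $\varepsilon\le\tilde\varepsilon$ outputs $y_h^K$ with $\|y_h^K-y_h^*\|_{L^2}^2\le C_4h^\nu$ for some $y_h^*\in Y_h^*$. $\mathcal T_{2M}$ is the set of positive sequences with $\varepsilon_1\le\tilde\varepsilon_1$, $\varepsilon_2\le\tilde\varepsilon_2(\varepsilon_1)$,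 ..., $\varepsilon_L\le\tilde\varepsilon_L(\varepsilon_1,\dots,\varepsilon_{L-1})$, where $\tilde\varepsilon_l(\varepsilon_1,\dots,\varepsilon_{l-1})>0$ is a threshold such that, when Algorithm 2M is run with $\varepsilon_1,\dots,\varepsilon_{l-1}$ on levels $1,\dots,l-1$ and any $\varepsilon_l\le\tilde\varepsilon_l(\varepsilon_1,\dots,\varepsilon_{l-1})$ on level $l$, one has $\|y^{K_l}_{h_l}-y^*_{h_l}\|_{L^2}^2\le C_4(h_l)^\nu$ for some $y^*_{h_l}\in Y^*_{h_l}$. Complexity. The complexity of Algorithm 2 is (number of iterations) $\times$ (cost of one iteration); that of Algorithm 2M is the sum of this quantity over the levels plus the cost of the interpolations between levels. Cost is the number of arithmetic operations; the projection onto $\{m_h:A_hm_h=\rho_h\}$ needed in the $m$-update is computed by inverting the discrete Laplacian with a $d$-dimensional FFT, an FFT on a grid with $N$ points per side costing $O(N^d\log(N^d))$; evaluating the proximal or projection operator associated with $\|\cdot\|_p$ at one vector of $\mathbb R^d$ costs $O(d)$ operations (the case for $p=1,2,\infty$). $O(\cdot)$ denotes the asymptotic rate as the tolerances and $h$ tend to $0$, with $d,p,\alpha,\nu,C_3,C_4$ fixed (the constants $C_3,C_4,\nu$ not depending on $h$, $l$, $L$). *)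

(* Defs.v *)
From HB Require Import structures.
From mathcomp Require Import all_boot all_order all_algebra.
From mathcomp Require Import all_classical all_reals all_analysis.
Set Implicit Arguments.
Unset Strict Implicit.
Unset Printing Implicit Defensive.
Import Order.TTheory GRing.Theory Num.Theory.
Import numFieldNormedType.Exports.
Local Open Scope classical_set_scope.
Local Open Scope ring_scope.

Definition unit_cube (R : realType) (d : nat) : set (d.-tuple R) :=
  [set x | forall i, 0 <= tnth x i <= 1].

(* The library has no Lebesgue measure on [R^d]. For a nonnegative measurable
   integrand, the iterated integral below is the Lebesgue integral over the
   cube, by Tonelli's theorem. *)
Fixpoint cube_integral (R : realType) (d : nat) :
    (d.-tuple R -> \bar R) -> \bar R :=
  match d return (d.-tuple R -> \bar R) -> \bar R with
  | 0 => fun f => f [tuple]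
  | d'.+1 => fun f =>
      (\int[lebesgue_measure]_(t in `[0%R, 1%R])
         cube_integral (fun x : d'.-tuple R => f (cons_tuple t x)))%E
  end.

Definition is_density (R : realType) (d : nat) (rho : d.-tuple R -> R) : Prop :=
  [/\ forall x, unit_cube x -> 0 <= rho x,
      measurable_fun (@unit_cube R d) rho
    & cube_integral (fun x => (rho x)%:E) = 1%E].

(* [x : grid d N] is the point [x / N] of [Omega^h], where [h = 1 / N]. *)
Definition grid (d N : nat) := {ffun 'I_d -> 'I_N.+1}.

Definition step (R : realType) (N : nat) : R := N%:R^-1.

Definition coord (R : realType) (d N : nat) (x : grid d N) (i : 'I_d) : R :=
  (x i)%:R * step R N.

Definition point (R : realType) (d N : nat) (x : grid d N) : d.-tuple R :=
  [tuple coord R x i | i < d].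

Definition rhoh (R : realType) (d N : nat) (rho0 rho1 : d.-tuple R -> R)
    (x : grid d N) : R :=
  rho0 (point R x) - rho1 (point R x).

Definition vfield (R : realType) (d N : nat) := {ffun grid d N -> 'rV[R]_d}.

Definition state (R : realType) (d N : nat) := (vfield R d N * vfield R d N)%type.

(* [x - h e_i]; only used when [x i] is not [0]. *)
Definition back (d N : nat) (x : grid d N) (i : 'I_d) : grid d N :=
  [ffun j => if j == i then inord (x i).-1 else x j].

Definition D_ (R : realType) (d N : nat) (i : 'I_d) (m : vfield R d N)
    (x : grid d N) : R :=
  if x i == 0%N :> nat then m x 0 i / step R N
  else if (x i < N)%N then (m x 0 i - m (back x i) 0 i) / step R N
  else - m (back x i) 0 i / step R N.

Definition A_ (R : realType) (d N : nat) (m : vfield R d N) (x : grid d N) : R :=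
  \sum_(i < d) D_ i m x.

Definition inner (R : realType) (d N : nat) (u v : vfield R d N) : R :=
  \sum_(x : grid d N) (\sum_(i < d) u x 0 i * v x 0 i) * step R N ^+ d.

Definition normsq (R : realType) (d N : nat) (u : vfield R d N) : R := inner u u.

Definition state_normsq (R : realType) (d N : nat) (y : state R d N) : R :=
  normsq y.1 + normsq y.2.

Definition pnorm (R : realType) (d : nat) (p : \bar R) (v : 'rV[R]_d) : R :=
  match p with
  | r%:E%E => (\sum_(i < d) `|v 0 i| `^ r) `^ r^-1
  | +oo%E => \big[Num.max/0]_(i < d) `|v 0 i|
  | -oo%E => 0
  end.

Definition f_ (R : realType) (d N : nat) (p : \bar R) (m : vfield R d N) : R :=
  \sum_(x : grid d N) pnorm p (m x) * step R N ^+ d.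

Definition fconj (R : realType) (d N : nat) (p : \bar R) (phi : vfield R d N) :
    \bar R :=
  ereal_sup (range (fun u : vfield R d N => (inner phi u - f_ p u)%:E)).

Definition delta (R : realType) (d N : nat) (rho0 rho1 : d.-tuple R -> R)
    (m : vfield R d N) : \bar R :=
  if `[< A_ m =1 rhoh rho0 rho1 >] then 0%E else +oo%E.

(* In [\bar R], [+oo - +oo = -oo]. *)
Definition Ltilde (R : realType) (d N : nat) (p : \bar R)
    (rho0 rho1 : d.-tuple R -> R) (m phi : vfield R d N) : \bar R :=
  (delta rho0 rho1 m - fconj p phi + (inner phi m)%:E)%E.

Definition Ystar (R : realType) (d N : nat) (p : \bar R)
    (rho0 rho1 : d.-tuple R -> R) : set (state R d N) :=
  [set y | (forall phi, Ltilde p rho0 rho1 y.1 phi <= Ltilde p rho0 rho1 y.1 y.2)%E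
        /\ (forall m, Ltilde p rho0 rho1 y.1 y.2 <= Ltilde p rho0 rho1 m y.2)%E].

Definition argmin (R : realType) (d N : nat) (F : vfield R d N -> \bar R) :
    vfield R d N :=
  xget 0 [set u | forall v, (F u <= F v)%E].

Definition argmax (R : realType) (d N : nat) (F : vfield R d N -> \bar R) :
    vfield R d N :=
  xget 0 [set u | forall v, (F v <= F u)%E].

Definition mu (R : realType) : R := 2^-1.
Definition tau (R : realType) : R := 2^-1.

(* The term [- fconj p phibar] of [Ltilde m phibar] does not depend on [m] and is
   dropped: the extrapolated [phibar] may leave the domain of [fconj], and then
   this term is [-oo] and every [m] would be a minimizer. *)
Definition m_update (R : realType) (d N : nat) (rho0 rho1 : d.-tuple R -> R)
    (m phibar : vfield R d N) : vfield R d N :=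
  argmin (fun u => delta rho0 rho1 u
                   + (inner phibar u + normsq (u - m) / (2 * mu R))%:E)%E.

Definition phi_update (R : realType) (d N : nat) (p : \bar R)
    (rho0 rho1 : d.-tuple R -> R) (m phi : vfield R d N) : vfield R d N :=
  argmax (fun u => Ltilde p rho0 rho1 m u
                   - (normsq (u - phi) / (2 * tau R))%:E)%E.

(* One iteration on the triple [(m, phi, phibar)]. *)
Definition alg2_step (R : realType) (d N : nat) (p : \bar R)
    (rho0 rho1 : d.-tuple R -> R) (s : vfield R d N * vfield R d N * vfield R d N) :
    vfield R d N * vfield R d N * vfield R d N :=
  let: (m, phi, phibar) := s in
  let m' := m_update rho0 rho1 m phibar in
  let phi' := phi_update p rho0 rho1 m' phi in
  (m', phi', 2 *: phi' - phi).

Definition alg2_iterate (R : realType) (d N : nat) (p : \bar R)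
    (rho0 rho1 : d.-tuple R -> R) (y0 : state R d N) (k : nat) : state R d N :=
  (iter k (alg2_step p rho0 rho1) (y0, y0.2)).1.

Definition G_ (R : realType) (d N : nat) (p : \bar R)
    (rho0 rho1 : d.-tuple R -> R) (y0 : state R d N) (k : nat) : R :=
  let dy := alg2_iterate p rho0 rho1 y0 k.+1 - alg2_iterate p rho0 rho1 y0 k in
  normsq dy.1 / mu R + normsq dy.2 / tau R + 2 * inner dy.2 dy.1.

Definition alg2_halts (R : realType) (d N : nat) (p : \bar R)
    (rho0 rho1 : d.-tuple R -> R) (y0 : state R d N) (eps : R) : Prop :=
  exists k, G_ p rho0 rho1 y0 k < eps.

(* The first [k] with [G_ k < eps], and [0] by convention if there is none. *)
Definition alg2_niter (R : realType) (d N : nat) (p : \bar R)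
    (rho0 rho1 : d.-tuple R -> R) (y0 : state R d N) (eps : R) : nat :=
  match pselect (alg2_halts p rho0 rho1 y0 eps) with
  | left halts => ex_minn halts
  | right _ => 0%N
  end.

Definition alg2_out (R : realType) (d N : nat) (p : \bar R)
    (rho0 rho1 : d.-tuple R -> R) (y0 : state R d N) (eps : R) : state R d N :=
  alg2_iterate p rho0 rho1 y0 (alg2_niter p rho0 rho1 y0 eps).

(* Interpolation goes from the grid of step [1 / N] to the one of step [1 / N']. *)
Definition in_J (R : realType) (d N N' : nat) (x : grid d N') (j : 'I_d) : bool :=
  [exists k : 'I_N.+1, coord R x j == k%:R * step R N].

Definition neighbors (R : realType) (d N N' : nat) (x : grid d N') :
    {set grid d N} :=
  [set y : grid d N | [forall j : 'I_d,
     if in_J R N x j then coord R y j == coord R x j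
     else `|coord R y j - coord R x j| <= step R N']].

Definition stencil (R : realType) (d N N' : nat) (i : 'I_d) (x : grid d N') :
    {set grid d N} :=
  if in_J R N x i then neighbors R N x
  else [set y in neighbors R N x | coord R y i == coord R x i - step R N'].

Definition interpolate_field (R : realType) (d N N' : nat) (m : vfield R d N) :
    vfield R d N' :=
  [ffun x => \row_(i < d)
     ((\sum_(y in stencil R N i x) m y 0 i) / #|stencil R N i x|%:R)].

Definition interpolate (R : realType) (d N N' : nat) (y : state R d N) :
    state R d N' :=
  (interpolate_field N' y.1, interpolate_field N' y.2).

(* Level [l >= 1] has step [h_l = 1 / gridN l]. *)
Definition gridN (l : nat) : nat := (2 ^ l.-1)%N.

Lemma gridN_log2 (R : realType) (L : nat) : (0 < L)%N ->
  L%:R = 1 + ln (step R (gridN L))^-1 / ln 2.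
Proof.
case: L => // L _; rewrite /step /gridN /= invrK natrX lnXn ?ltr0n //.
have ln2 : ln 2 != 0 :> R by rewrite gt_eqF // ln_gt0 // ltr1n.
by rewrite -[ln 2 *+ L]mulr_natl mulfK // -natr1 addrC.
Qed.

Lemma step_gridN (R : realType) (L l : nat) : (0 < l <= L)%N ->
  step R (gridN l) = 2 ^+ (L - l) * step R (gridN L).
Proof.
case: l => // l; case: L => // L /andP[_]; rewrite ltnS => lL.
have p2 k : 2 ^+ k != 0 :> R by rewrite expf_neq0 // pnatr_eq0.
rewrite /step /gridN subSS /= !natrX.
by rewrite -[in X in _ / X](subnK lL) exprD invfM mulrA divff ?mul1r.
Qed.

(* The starting point of level [l], of which only [eps 1], ..., [eps l.-1]
   matter. *)
Fixpoint alg2M_start (R : realType) (d : nat) (p : \bar R)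
    (rho0 rho1 : d.-tuple R -> R) (eps : nat -> R) (l : nat) :
    state R d (gridN l) :=
  match l with
  | 0 => 0
  | l1.+1 =>
      if l1 == 0%N then 0
      else interpolate (gridN l1.+1)
             (alg2_out p rho0 rho1 (alg2M_start p rho0 rho1 eps l1) (eps l1))
  end.

Definition threshold2 (R : realType) (d N : nat) (p : \bar R)
    (rho0 rho1 : d.-tuple R -> R) (C4 nu : R) (t : R) : Prop :=
  0 < t /\ forall e, 0 < e <= t ->
    exists2 y, @Ystar R d N p rho0 rho1 y &
      state_normsq (alg2_out p rho0 rho1 0 e - y) <= C4 * step R N `^ nu.

Definition T2 (R : realType) (d N : nat) (p : \bar R)
    (rho0 rho1 : d.-tuple R -> R) (C4 nu : R) : set R :=
  [set e | 0 < e /\ exists2 t, threshold2 N p rho0 rho1 C4 nu t & e <= t].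

(* [t] is a threshold for level [l], given [eps 1], ..., [eps l.-1]. *)
Definition threshold2M (R : realType) (d : nat) (p : \bar R)
    (rho0 rho1 : d.-tuple R -> R) (C4 nu : R) (eps : nat -> R) (l : nat) (t : R) :
    Prop :=
  0 < t /\ forall e, 0 < e <= t ->
    exists2 y, @Ystar R d (gridN l) p rho0 rho1 y &
      state_normsq (alg2_out p rho0 rho1 (alg2M_start p rho0 rho1 eps l) e - y)
        <= C4 * step R (gridN l) `^ nu.

Definition T2M (R : realType) (d : nat) (p : \bar R)
    (rho0 rho1 : d.-tuple R -> R) (C4 nu : R) (L : nat) : set (nat -> R) :=
  [set eps | forall l, (0 < l <= L)%N ->
     0 < eps l /\ exists2 t, threshold2M p rho0 rho1 C4 nu eps l t & eps l <= t].

Definition npts (d N : nat) : nat := #|grid d N|.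

(* Per point, [D_ i] takes one division and, except at [x i = 0], one subtraction
   or sign change; the [d] summands take [d.-1] additions. *)
Definition A_ops (d N : nat) : nat :=
  (\sum_(x : grid d N) (\sum_(i < d) (if x i == 0 :> nat then 1 else 2) + d.-1))%N.

(* The adjoint [(A* u)_i(x) = (u(x) - u(x + h e_i)) / h] if [x_i < 1], and [0]
   otherwise. *)
Definition A_adj_ops (d N : nat) : nat :=
  (\sum_(x : grid d N) \sum_(i < d) (if x i < N then 2 else 0))%N.

(* [m' = v - A* (A A* )^+ (A v - rho_h)] with [v = m - mu phibar]; the discrete
   Laplacian [A A*] is inverted by a forward transform, a division by the
   eigenvalues and a backward transform, on [N + 1] points per side. *)
Definition m_update_ops (fft_ops : nat -> nat) (d N : nat) : nat :=
  (2 * (d * npts d N)                   (* v *)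
   + A_ops d N + npts d N               (* A v - rho_h *)
   + (2 * fft_ops N.+1 + npts d N)      (* inversion of A A* *)
   + A_adj_ops d N + d * npts d N)%N.   (* v - A* (...) *)

(* [phi'(x)] is the projection of [phi(x) + tau m'(x)] onto the unit ball of the
   dual norm of [pnorm p]. *)
Definition phi_update_ops (prox_ops : nat -> nat) (d N : nat) : nat :=
  (2 * (d * npts d N) + npts d N * prox_ops d)%N.

(* Two differences, three inner products, and their combination. *)
Definition G_ops (d N : nat) : nat :=
  (2 * (d * npts d N) + 3 * (2 * (d * npts d N)) + 5)%N.

Definition iter_ops (fft_ops prox_ops : nat -> nat) (d N : nat) : nat :=
  (m_update_ops fft_ops d N + phi_update_ops prox_ops d N
   + 2 * (d * npts d N)                 (* 2 phi' - phi *)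
   + G_ops d N)%N.

(* An average of [n] numbers takes [n.-1] additions and a division; both fields
   of the state are interpolated. *)
Definition interp_ops (R : realType) (d N N' : nat) : nat :=
  (2 * \sum_(x : grid d N') \sum_(i < d) #|stencil R N i x|)%N.

Definition alg2_cost (R : realType) (fft_ops prox_ops : nat -> nat) (d N : nat)
    (p : \bar R) (rho0 rho1 : d.-tuple R -> R) (y0 : state R d N) (eps : R) :
    \bar R :=
  if `[< alg2_halts p rho0 rho1 y0 eps >] then
    (alg2_niter p rho0 rho1 y0 eps * iter_ops fft_ops prox_ops d N)%N%:R%:E
  else +oo%E.

Definition complexity2 (R : realType) (fft_ops prox_ops : nat -> nat) (d N : nat)
    (p : \bar R) (rho0 rho1 : d.-tuple R -> R) (eps : R) : \bar R :=
  alg2_cost fft_ops prox_ops p rho0 rho1 (0 : state R d N) eps.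

Definition complexity2M (R : realType) (fft_ops prox_ops : nat -> nat) (d : nat)
    (p : \bar R) (rho0 rho1 : d.-tuple R -> R) (L : nat) (eps : nat -> R) :
    \bar R :=
  (\sum_(1 <= l < L.+1)
      alg2_cost fft_ops prox_ops p rho0 rho1 (alg2M_start p rho0 rho1 eps l) (eps l)
   + (\sum_(2 <= l < L.+1) interp_ops R d (gridN l.-1) (gridN l))%N%:R%:E)%E.

(* Main.v *)
(* Read with the pairing (m_{k+1}, phi_k), the primal-dual iteration is a
   proximal point iteration in the metric 2|m|^2 + 2|phi|^2 + 2<phi, m>, so it is
   Fejer monotone and its squared increments have a sum bounded by a multiple of
   the initial squared distance to a saddle point. The residual G_k is controlled
   by these increments (it pairs them without the shift, which costs only the
   first increment of m), hence Algorithm 2 stops after at most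
   30 |y^0 - y*|^2 / eps iterations. Started from zero, this distance is bounded
   by C_3; in Algorithm 2M the interpolated output of level l - 1 is within a
   multiple of h_l^nu of a saddle point, because interpolation is bounded in L^2.
   Multiplying by the cost of an iteration, of order d h_l^{-d} log(1/h), leaves
   a geometric sum of h_l^(nu - d - alpha) over the levels. *)
Require Import Defs.
From mathcomp Require Import all_boot all_order all_algebra.
From mathcomp Require Import all_classical all_reals all_analysis.
From mathcomp Require Import ring lra zify.
Import Order.TTheory GRing.Theory Num.Theory.
Import numFieldNormedType.Exports.
Local Open Scope classical_set_scope.
Local Open Scope ring_scope.

Set Implicit Arguments.
Unset Strict Implicit.
Unset Printing Implicit Defensive.

(** * The weighted inner product on vector fields *)

Lemma step_gt0 (R : realType) N : (0 < N)%N -> 0 < step R N.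
Proof. by move=> N0; rewrite /step invr_gt0 ltr0n. Qed.

Lemma innerC (R : realType) d N (u v : vfield R d N) : inner u v = inner v u.
Proof.
apply: eq_bigr => x _; congr (_ * _); apply: eq_bigr => i _; exact: mulrC.
Qed.

Lemma innerDl (R : realType) d N (u v w : vfield R d N) :
  inner (u + v) w = inner u w + inner v w.
Proof.
rewrite -big_split; apply: eq_bigr => x _ /=; rewrite -mulrDl -big_split.
by congr (_ * _); apply: eq_bigr => i _; rewrite !ffunE mxE mulrDl.
Qed.

Lemma innerZl (R : realType) d N a (u w : vfield R d N) :
  inner (a *: u) w = a * inner u w.
Proof.
rewrite mulr_sumr; apply: eq_bigr => x _; rewrite mulrA mulr_sumr.
by congr (_ * _); apply: eq_bigr => i _; rewrite !ffunE mxE mulrA.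
Qed.

Lemma innerNl (R : realType) d N (u w : vfield R d N) :
  inner (- u) w = - inner u w.
Proof. by rewrite -scaleN1r innerZl mulN1r. Qed.

Lemma innerDr (R : realType) d N (u v w : vfield R d N) :
  inner w (u + v) = inner w u + inner w v.
Proof. by rewrite innerC innerDl !(innerC w). Qed.

Lemma innerNr (R : realType) d N (u w : vfield R d N) :
  inner w (- u) = - inner w u.
Proof. by rewrite innerC innerNl (innerC w). Qed.

Lemma innerZr (R : realType) d N a (u w : vfield R d N) :
  inner w (a *: u) = a * inner w u.
Proof. by rewrite innerC innerZl (innerC w). Qed.

Lemma inner0l (R : realType) d N (w : vfield R d N) : inner 0 w = 0.
Proof. by rewrite -(scale0r w) innerZl mul0r. Qed.

Definition innerE := (innerDl, innerDr, innerNl, innerNr, innerZl, innerZr).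

Lemma normsq_ge0 (R : realType) d N (u : vfield R d N) : 0 <= normsq u.
Proof.
apply: sumr_ge0 => x _; apply: mulr_ge0; last first.
  by rewrite exprn_ge0 // invr_ge0 ler0n.
by apply: sumr_ge0 => i _; rewrite -expr2 sqr_ge0.
Qed.

Lemma normsqD_le (R : realType) d N (u v : vfield R d N) :
  normsq (u + v) <= 2 * normsq u + 2 * normsq v.
Proof.
have := normsq_ge0 (u - v); rewrite /normsq !innerE (innerC v u).
lra.
Qed.

Lemma sqr_coord_le_normsq (R : realType) d N (u : vfield R d N) x i :
  u x 0 i ^+ 2 * step R N ^+ d <= normsq u.
Proof.
have h0 : 0 <= step R N ^+ d by rewrite exprn_ge0 // invr_ge0 ler0n.
rewrite /normsq /inner (bigD1 x) //= (bigD1 i) //= -expr2 mulrDl -addrA lerDl.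
apply: addr_ge0.
  by rewrite mulr_ge0 // sumr_ge0 // => j _; rewrite -expr2 sqr_ge0.
apply: sumr_ge0 => y _; rewrite mulr_ge0 // sumr_ge0 // => j _.
by rewrite -expr2 sqr_ge0.
Qed.

(** * Topology of fields and projection onto closed convex sets *)

Definition vec_field (R : realType) d N (z : 'rV[R]_#|{: grid d N * 'I_d}|) :
    vfield R d N :=
  [ffun x => \row_i z 0 (enum_rank (x, i))].

Definition field_vec (R : realType) d N (u : vfield R d N) :
    'rV[R]_#|{: grid d N * 'I_d}| :=
  \row_j u (enum_val j).1 0 (enum_val j).2.

Lemma field_vecK (R : realType) d N :
  cancel (@field_vec R d N) (@vec_field R d N).
Proof.
by move=> u; apply/ffunP => x; apply/rowP => i; rewrite ffunE !mxE enum_rankK.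
Qed.

Lemma vec_field_continuous (R : realType) d N x i :
  continuous (fun z => @vec_field R d N z x 0 i : R).
Proof.
rewrite (_ : (fun _ => _) =
  (fun z : 'rV[R]_#|{: grid d N * 'I_d}| => z 0 (enum_rank (x, i)))).
  exact: coord_continuous.
by apply/funext => z; rewrite ffunE mxE.
Qed.

Lemma continuous_add (R : realType) (T : topologicalType) (f g : T -> R) :
  continuous f -> continuous g -> continuous (fun z => f z + g z).
Proof. by move=> cf cg z; apply: (@cvgD _ R^o); [exact: cf|exact: cg]. Qed.

Lemma continuous_opp (R : realType) (T : topologicalType) (f : T -> R) :
  continuous f -> continuous (fun z => - f z).
Proof. by move=> cf z; apply: (@cvgN _ R^o); exact: cf. Qed.

Lemma continuous_mul (R : realType) (T : topologicalType) (f g : T -> R) :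
  continuous f -> continuous g -> continuous (fun z => f z * g z).
Proof. by move=> cf cg z; apply: (@cvgM R); [exact: cf|exact: cg]. Qed.

Lemma continuous_sum (R : realType) (T : topologicalType) (I : Type)
    (r : seq I) (P : pred I) (F : I -> T -> R) :
  (forall i, P i -> continuous (F i)) ->
  continuous (fun z => \sum_(i <- r | P i) F i z).
Proof.
move=> cF; apply: (@continuous_big R) cF.
by move=> z; exact: (@add_continuous R).
Qed.

Lemma continuous_inner (R : realType) (T : topologicalType) d N
    (F G : T -> vfield R d N) :
  (forall x i, continuous (fun z => F z x 0 i)) ->
  (forall x i, continuous (fun z => G z x 0 i)) ->
  continuous (fun z => inner (F z) (G z)).
Proof.
move=> cF cG; apply: continuous_sum => x _.
apply: continuous_mul; last exact: cst_continuous.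
by apply: continuous_sum => i _; exact: continuous_mul.
Qed.

(** Closedness is read through [vec_field]: on row vectors the compactness of boxes and the extreme
    value theorem are available. *)
Definition closed_convex (R : realType) d N (K : set (vfield R d N)) :=
  closed (@vec_field R d N @^-1` K) /\
  (forall u v t, K u -> K v -> 0 <= t <= 1 -> K (u + t *: (v - u))).

(** The part of [K] no farther from [v] than a given point [u0] is closed and lies in a box, hence
    is compact, and the distance attains its minimum there. *)
Lemma projection_exists (R : realType) d N (K : set (vfield R d N)) v :
  (0 < N)%N -> closed_convex K -> K !=set0 ->
  exists2 u, K u & forall w, K w -> normsq (u - v) <= normsq (w - v).
Proof.
move=> N0 [Kcl _] [u0 Ku0].
pose g z := normsq (vec_field z - v).
have cg : continuous g.
  have cF x i : continuous (fun z => (vec_field z - v) x 0 i).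
    rewrite (_ : (fun _ => _) = (fun z => vec_field z x 0 i - v x 0 i)).
      apply: continuous_add.
        exact: vec_field_continuous.
      exact: cst_continuous.
    by apply/funext => z; rewrite !ffunE !mxE.
  exact: continuous_inner.
pose A := @vec_field R d N @^-1` K `&` [set z | g z <= normsq (u0 - v)].
have A0 : A !=set0.
  by exists (field_vec u0); rewrite /A /g /= field_vecK; split.
have cA : closed A.
  apply: closedI => //; apply: (preimage_closed _ (@closed_le R _)).
  by move=> z _; exact: cg.
set c := normsq (u0 - v) in A A0 cA *.
have hd0 : 0 < step R N ^+ d by rewrite exprn_gt0 // step_gt0.
pose s := c / step R N ^+ d + 1.
(* [|b - a|] is at most [(b - a) ^+ 2 + 1]; this avoids a square root and explains the [+ 1] in
   [s]. *)
have box (a b e : R) : (b - a) ^+ 2 <= e -> a - (e + 1) <= b <= a + (e + 1).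
  have := sqr_ge0 (b - a - 1); have := sqr_ge0 (b - a + 1).
  by have := sqr_ge0 (b - a) => *; apply/andP; split; nra.
have kA : compact A.
  have kbox : compact [set z : 'rV[R]_#|{: grid d N * 'I_d}| | forall j,
      z 0 j \in `[(field_vec v) 0 j - s, (field_vec v) 0 j + s]].
    apply: (@rV_compact R^o _ (fun j =>
      `[(field_vec v) 0 j - s, (field_vec v) 0 j + s]%classic)) => j.
    exact: segment_compact.
  apply: (subclosed_compact cA kbox).
  move=> z [_ /= gz] j.
  have := sqr_coord_le_normsq (vec_field z - v)
            (enum_val j).1 (enum_val j).2.
  move=> /le_trans/(_ gz); rewrite -ler_pdivlMr // !ffunE !mxE.
  rewrite -surjective_pairing enum_valK /= in_itv /= /s.
  exact: box.
have [z /set_mem[Kz gz] zmin] := EVT_min_rV A0 kA (continuous_subspaceT cg).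
exists (vec_field z) => // w Kw.
have [wc|wc] := leP (normsq (w - v)) c; last exact: le_trans gz (ltW wc).
have := zmin (field_vec w); rewrite /g field_vecK; apply.
by apply/mem_set; split; rewrite /= /g field_vecK.
Qed.

(** If the pairing were positive, a move from [u] towards [w] inside [K] would come closer to
    [v]. *)
Lemma projection_obtuse (R : realType) d N (K : set (vfield R d N)) u v w :
  closed_convex K -> K u ->
  (forall w, K w -> normsq (u - v) <= normsq (w - v)) ->
  K w -> inner (v - u) (w - u) <= 0.
Proof.
move=> [_ Kcvx] Ku umin Kw; rewrite leNgt; apply/negP => pos.
pose b := normsq (w - u); pose a := inner (v - u) (w - u).
have b0 : 0 <= b := normsq_ge0 _.
have a0 : 0 < a by [].
(* The squared distance changes by [t ^+ 2 * b - 2 * t * a], negative for this [t]; having [a] in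
   the denominator keeps [t] at most 1 and covers [b = 0]. *)
pose t := a / (a + b).
have ab0 : 0 < a + b by lra.
have t01 : 0 <= t <= 1.
  apply/andP; split; first exact: divr_ge0 (ltW a0) (ltW ab0).
  by rewrite ler_pdivrMr // mul1r lerDl.
have tab : t * (a + b) = a by rewrite /t divfK // gt_eqF.
have t0 : 0 < t by rewrite /t divr_gt0.
have := umin _ (Kcvx _ _ t Ku Kw t01).
rewrite [X in _ <= normsq X](_ : _ = t *: (w - u) - (v - u)); last first.
  by rewrite opprB addrCA addrA.
rewrite [X in normsq X <= _](_ : _ = - (v - u)); last by rewrite opprB.
have -> : normsq (t *: (w - u) - (v - u))
   = t ^+ 2 * b - 2 * t * a + normsq (- (v - u)).
  rewrite /a /b /normsq; move: (w - u) (v - u) => p q.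
  by rewrite !innerE (innerC q p); ring.
by nra.
Qed.

(** * The p-norm, its conjugate and the polar set *)

Lemma pnormZ (R : realType) d (p : \bar R) t (v : 'rV[R]_d) :
  (1 <= p)%E -> 0 <= t -> pnorm p (t *: v) = t * pnorm p v.
Proof.
move=> p1 t0; case: p p1 => [r||] //= r1.
- have r0 : 0 < r by move: r1; rewrite lee_fin => /(lt_le_trans ltr01).
  rewrite (eq_bigr (fun i => t `^ r * `|v 0 i| `^ r)); last first.
    by move=> i _; rewrite mxE normrM (ger0_norm t0) powRM.
  rewrite -mulr_sumr powRM ?powR_ge0 //; last first.
    by apply: sumr_ge0 => i _; exact: powR_ge0.
  by rewrite -powRrM mulfV ?gt_eqF // powRr1.
- rewrite (eq_bigr (fun i => t * `|v 0 i|)); last first.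
    by move=> i _; rewrite mxE normrM (ger0_norm t0).
  elim/big_rec2: _ => [|i x y _ ->]; first by rewrite mulr0.
  by rewrite maxr_pMr.
Qed.

Lemma pnorm_ge0 (R : realType) d (p : \bar R) (v : 'rV[R]_d) : 0 <= pnorm p v.
Proof.
case: p => [r||] //=; first exact: powR_ge0.
exact: bigmax_ge_id.
Qed.

Lemma f_Z (R : realType) d N (p : \bar R) t (u : vfield R d N) :
  (1 <= p)%E -> 0 <= t -> f_ p (t *: u) = t * f_ p u.
Proof.
move=> p1 t0; rewrite /f_ mulr_sumr; apply: eq_bigr => x _.
by rewrite ffunE pnormZ // mulrA.
Qed.

Lemma f_ge0 (R : realType) d N (p : \bar R) (u : vfield R d N) : 0 <= f_ p u.
Proof.
apply: sumr_ge0 => x _; rewrite mulr_ge0 ?pnorm_ge0 //.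
by rewrite exprn_ge0 // invr_ge0 ler0n.
Qed.

(** For [p >= 1] this is pointwise the unit ball of the dual norm; as an intersection of half-spaces
    it is visibly closed and convex. *)
Definition polar (R : realType) d N (p : \bar R) : set (vfield R d N) :=
  [set phi | forall u, inner phi u <= f_ p u].

Definition feasible (R : realType) d N (rho0 rho1 : d.-tuple R -> R) :
    set (vfield R d N) :=
  [set m | A_ m =1 rhoh rho0 rho1].

Lemma polar0 (R : realType) d N (p : \bar R) : polar p (0 : vfield R d N).
Proof. by move=> u; rewrite inner0l f_ge0. Qed.

(* Positive homogeneity of [f_ p] makes its conjugate an indicator function. *)
Lemma fconjE (R : realType) d N (p : \bar R) (phi : vfield R d N) :
  (1 <= p)%E -> fconj p phi = if `[< polar p phi >] then 0%E else +oo%E.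
Proof.
move=> p1; case: asboolP => [pphi|/existsNP[u /negP]].
  apply/le_anti/andP; split.
    by apply: ge_ereal_sup => _ [u _ <-]; rewrite lee_fin subr_le0.
  apply: ereal_sup_ubound; exists 0 => //.
  have -> : f_ p (0 : vfield R d N) = 0.
    by rewrite -(scale0r (0 : vfield R d N)) f_Z // mul0r.
  by rewrite innerC inner0l subrr.
rewrite -ltNge => lt_u; apply: eq_infty => M.
have c0 : 0 < inner phi u - f_ p u by rewrite subr_gt0.
(* The gap [inner phi u - f_ p u] grows linearly along the ray through [u], so this multiple reaches
   [M]; the maximum with 0 keeps the scaling nonnegative, as [f_Z] requires. *)
pose t := Num.max 0 (M / (inner phi u - f_ p u)).
have t0 : 0 <= t by rewrite le_max lexx.
apply: (@le_trans _ _ (inner phi (t *: u) - f_ p (t *: u))%:E).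
  rewrite lee_fin f_Z // innerZr -mulrBr -ler_pdivrMr //.
  by rewrite le_max lexx orbT.
by apply: ereal_sup_ubound; exists (t *: u).
Qed.

Lemma polar_closed_convex (R : realType) d N (p : \bar R) :
  closed_convex (polar p : set (vfield R d N)).
Proof.
split=> [|u v t pu pv /andP[t0 t1] w].
  rewrite (_ : _ @^-1` _ =
    \bigcap_u [set z | inner (@vec_field R d N z) u <= f_ p u]); last first.
    by apply/seteqP; split=> [z pz u _|z pz u]; exact: pz.
  apply: closed_bigI => u _.
  apply: (preimage_closed _ (@closed_le R _)) => z _.
  move: z; apply: continuous_inner => x i; first exact: vec_field_continuous.
  exact: cst_continuous.
have := pu w; have := pv w; rewrite !innerE.
move: (inner u w) (inner v w) (f_ p w) => a b c ca cb.
have -> : a + t * (b - a) = (1 - t) * a + t * b by ring.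
by nra.
Qed.

(** * The affine constraint and the two updates as projections *)

Lemma A_D (R : realType) d N (u v : vfield R d N) t x :
  A_ (u + t *: v) x = A_ u x + t * A_ v x.
Proof.
rewrite /A_ mulr_sumr -big_split; apply: eq_bigr => i _.
rewrite /D_ !ffunE !mxE.
by case: ifP => _ /=; [ring|case: ifP => _; ring].
Qed.

Lemma feasible_closed_convex (R : realType) d N (rho0 rho1 : d.-tuple R -> R) :
  closed_convex (feasible rho0 rho1 : set (vfield R d N)).
Proof.
split=> [|u v t fu fv _ x]; last first.
  by rewrite A_D -scaleN1r addrC A_D fu fv; ring.
rewrite (_ : _ @^-1` _ =
  \bigcap_x [set z | A_ (@vec_field R d N z) x = rhoh rho0 rho1 x]); last first.
  by apply/seteqP; split=> [z pz u _|z pz u]; exact: pz.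
apply: closed_bigI => x _.
apply: (preimage_closed _ (@closed_eq R _)) => z _.
move: z; apply: continuous_sum => i _; rewrite /D_.
have cV y : continuous (fun z => @vec_field R d N z y 0 i).
  exact: vec_field_continuous.
have cN y : continuous (fun z => - @vec_field R d N z y 0 i).
  exact: continuous_opp.
case: (x i == 0%N :> nat); last case: (x i < N)%N.
- by apply: continuous_mul => //; exact: cst_continuous.
- apply: continuous_mul; last exact: cst_continuous.
  exact: continuous_add.
- by apply: continuous_mul => //; exact: cst_continuous.
Qed.

Lemma deltaE (R : realType) d N (rho0 rho1 : d.-tuple R -> R)
    (m : vfield R d N) : feasible rho0 rho1 m -> delta rho0 rho1 m = 0%E.
Proof. by move=> fm; rewrite /delta; case: asboolP. Qed.

(** Completing the square turns the objective on the feasible set into the squared distance to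
    [m - 2^-1 *: phibar], up to a constant, so the update is a projection. *)
Lemma m_updateP (R : realType) d N (rho0 rho1 : d.-tuple R -> R)
    (m phibar : vfield R d N) :
  (0 < N)%N -> @feasible R d N rho0 rho1 !=set0 ->
  let m' := m_update rho0 rho1 m phibar in
  feasible rho0 rho1 m' /\ forall w, feasible rho0 rho1 w ->
    inner (m - 2^-1 *: phibar - m') (w - m') <= 0.
Proof.
move=> N0 fne m'; pose v := m - 2^-1 *: phibar.
have cK := feasible_closed_convex N rho0 rho1.
have sq u : inner phibar u + normsq (u - m) / (2 * mu R) =
    normsq (u - v) + (inner phibar m - normsq phibar / 4).
  rewrite /v /mu mulfV // divr1 /normsq !innerE.
  by rewrite (innerC u m) (innerC u phibar) (innerC m phibar); field.
have [u0 fu0 u0min] := projection_exists v N0 cK fne.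
pose F u := (delta rho0 rho1 u
  + (inner phibar u + normsq (u - m) / (2 * mu R))%:E)%E.
(* [xget] returns its default 0 unless a minimizer exists; the projection supplies one. *)
have mmin : forall u, (F m' <= F u)%E.
  apply: (@xgetPex _ 0 [set u | forall w, (F u <= F w)%E]).
  exists u0 => u; rewrite /F (deltaE fu0) add0e /delta.
  case: asboolP => [fu|_]; last by rewrite leey.
  by rewrite add0e lee_fin !sq lerD2r; exact: u0min.
have fm : feasible rho0 rho1 m'.
  have := mmin u0; rewrite /F (deltaE fu0) add0e {1}/delta.
  by case: asboolP.
split=> // w fw; apply: (projection_obtuse cK fm _ fw) => {w fw} w fw.
have := mmin w; rewrite /F (deltaE fw) (deltaE fm) !add0e lee_fin !sq.
by rewrite lerD2r.
Qed.

(** The conjugate being the indicator of [polar p], maximizing amounts to projecting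
    [phi + 2^-1 *: m] onto that set. *)
Lemma phi_updateP (R : realType) d N (p : \bar R) (rho0 rho1 : d.-tuple R -> R)
    (m phi : vfield R d N) :
  (0 < N)%N -> (1 <= p)%E -> feasible rho0 rho1 m ->
  let phi' := phi_update p rho0 rho1 m phi in
  polar p phi' /\ forall w, polar p w ->
    inner (phi + 2^-1 *: m - phi') (w - phi') <= 0.
Proof.
move=> N0 p1 fm phi'; pose v := phi + 2^-1 *: m.
have cK := polar_closed_convex d N p.
have sq u : inner u m - normsq (u - phi) / (2 * tau R) =
    - normsq (u - v) + (inner phi m + normsq m / 4).
  rewrite /v /tau mulfV // divr1 /normsq !innerE.
  by rewrite (innerC u m) (innerC u phi) (innerC m phi); field.
have [u0 pu0 u0min] :=
  projection_exists v N0 cK (ex_intro _ 0 (@polar0 R d N p)).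
pose F u := (Ltilde p rho0 rho1 m u - (normsq (u - phi) / (2 * tau R))%:E)%E.
have FE u : F u = if `[< polar p u >]
    then (- normsq (u - v) + (inner phi m + normsq m / 4))%:E else -oo%E.
  rewrite /F /Ltilde (deltaE fm) fconjE //; case: asboolP => // _.
  by rewrite sube0 add0e -EFinB sq.
have pmax : forall u, (F u <= F phi')%E.
  apply: (@xgetPex _ 0 [set u | forall w, (F w <= F u)%E]).
  exists u0 => u; rewrite !FE (asboolT pu0); case: asboolP => [pu|_].
    by rewrite lee_fin lerD2r lerN2; exact: u0min.
  by rewrite leNye.
have pphi : polar p phi'.
  by have := pmax u0; rewrite !FE (asboolT pu0); case: asboolP.
split=> // w pw; apply: (projection_obtuse cK pphi _ pw) => {w pw} w pw.
have := pmax w.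
by rewrite !FE (asboolT pphi) (asboolT pw) lee_fin lerD2r lerN2.
Qed.

(** * Saddle points and feasibility of the constraint *)

Lemma saddleP (R : realType) d N (p : \bar R) (rho0 rho1 : d.-tuple R -> R)
    (y : state R d N) :
  (1 <= p)%E -> @feasible R d N rho0 rho1 !=set0 ->
  Ystar p rho0 rho1 y ->
  [/\ feasible rho0 rho1 y.1, polar p y.2,
      forall phi, polar p phi -> inner phi y.1 <= inner y.2 y.1
    & forall m, feasible rho0 rho1 m -> inner y.2 y.1 <= inner y.2 m].
Proof.
case: y => m phi /= p1 [m0 fm0] [/= ymax ymin].
have p0 := @polar0 R d N p.
have fm : feasible rho0 rho1 m.
  (* At [(m, 0)] the value of [Ltilde] is the indicator of the constraint at [m]; it is bounded by
     the value at [(m0, phi)], which is below [+oo] because [m0] is feasible. *)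
  have := le_trans (ymax 0) (ymin m0).
  rewrite /Ltilde !fconjE // (deltaE fm0) (asboolT p0) sube0 add0e.
  by rewrite {1}/delta inner0l; case: asboolP => // _; case: asboolP.
have pphi : polar p phi.
  have := ymax 0; rewrite /Ltilde !fconjE // (deltaE fm).
  by rewrite (asboolT p0) inner0l; case: (asboolP (polar p phi)).
split=> // [psi ppsi|m1 fm1].
  have := ymax psi; rewrite /Ltilde !fconjE // (asboolT pphi) (asboolT ppsi).
  by rewrite (deltaE fm) sube0 !add0e lee_fin.
have := ymin m1; rewrite /Ltilde !fconjE // (asboolT pphi) !deltaE //.
by rewrite sube0 !add0e lee_fin.
Qed.

Lemma infeasible_saddle (R : realType) d N (p : \bar R)
    (rho0 rho1 : d.-tuple R -> R) (m : vfield R d N) :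
  (1 <= p)%E -> ~ (@feasible R d N rho0 rho1 !=set0) ->
  Ystar p rho0 rho1 (m, 0).
Proof.
move=> p1 fN.
have dE u : delta rho0 rho1 (u : vfield R d N) = +oo%E.
  by rewrite /delta; case: asboolP => // fu; case: fN; exists u.
have L0 u : Ltilde p rho0 rho1 u (0 : vfield R d N) = +oo%E.
  by rewrite /Ltilde dE fconjE // asboolT //; exact: polar0.
by split=> /= [phi|u]; rewrite !L0 ?leey.
Qed.

(* When the constraint has no solution, [Ltilde] takes the value [+oo] at every
   [(m, 0)], so the saddle set is unbounded. *)
Lemma bounded_saddle_feasible (R : realType) d N (p : \bar R)
    (rho0 rho1 : d.-tuple R -> R) C :
  (0 < d)%N -> (0 < N)%N -> (1 <= p)%E ->
  (forall y : state R d N, Ystar p rho0 rho1 y -> state_normsq y <= C) ->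
  @feasible R d N rho0 rho1 !=set0.
Proof.
case: d rho0 rho1 => // d rho0 rho1 _ N0 p1 bnd; apply: contrapT => fN.
have hd0 : 0 < step R N ^+ d.+1 by rewrite exprn_gt0 // step_gt0.
pose x0 : grid d.+1 N := [ffun=> ord0].
(* One coordinate of the constant field already contributes [t ^+ 2 * step R N ^+ d.+1], which
   exceeds [|C|] since [(a + 1) ^+ 2 > a] for [a >= 0]. *)
pose t := `|C| / step R N ^+ d.+1 + 1.
pose m : vfield R d.+1 N := [ffun=> const_mx t].
have := bnd _ (infeasible_saddle m p1 fN); rewrite /state_normsq /= leNgt.
move/negP; apply; rewrite [normsq 0]inner0l addr0.
apply: lt_le_trans (sqr_coord_le_normsq m x0 ord0).
rewrite ffunE mxE -ltr_pdivrMr //.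
apply: (@le_lt_trans _ _ (`|C| / step R N ^+ d.+1)).
  by rewrite ler_pM2r ?invr_gt0 // ler_norm.
rewrite /t; have : 0 <= `|C| / step R N ^+ d.+1 by rewrite divr_ge0 // ltW.
by move: (_ / _) => a a0; nra.
Qed.

(** * Fejer monotonicity and the iteration bound *)

Definition pd_normsq (R : realType) d N (m phi : vfield R d N) : R :=
  2 * normsq m + 2 * normsq phi + 2 * inner phi m.

Lemma pd_normsq_ge (R : realType) d N (m phi : vfield R d N) :
  normsq m + normsq phi <= pd_normsq m phi.
Proof.
have := normsq_ge0 (m + phi); rewrite /pd_normsq /normsq !innerE (innerC m phi).
lra.
Qed.

Lemma pd_normsq_le (R : realType) d N (m phi : vfield R d N) :
  pd_normsq m phi <= 3 * (normsq m + normsq phi).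
Proof.
have := normsq_ge0 (m - phi); rewrite /pd_normsq /normsq !innerE (innerC m phi).
lra.
Qed.

(* The pairing is shifted: [m'] is computed from the extrapolation of the step
   from [phi] to [phi'], and [phi'] from [m]. *)
Lemma pd_fejer (R : realType) d N (m m' ms phi phi' phis : vfield R d N) :
  inner (m - 2^-1 *: (2 *: phi' - phi) - m') (ms - m') <= 0 ->
  inner (phi + 2^-1 *: m - phi') (phis - phi') <= 0 ->
  inner phis ms <= inner phis m' -> inner phi' ms <= inner phis ms ->
  pd_normsq (m' - m) (phi' - phi)
    <= pd_normsq (m - ms) (phi - phis) - pd_normsq (m' - ms) (phi' - phis).
Proof.
(* The right side minus the left is twice the inner product, in this metric, of
   [(m - m', phi - phi')] and [(m' - ms, phi' - phis)]. It is the sum of the four hypotheses with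
   weights 4, 4, 2, 2. *)
rewrite /pd_normsq /normsq !innerE.
rewrite ?(innerC m phi) ?(innerC m phi') ?(innerC m phis) ?(innerC m' phi).
rewrite ?(innerC m' phi') ?(innerC m' phis) ?(innerC ms phi) ?(innerC ms phi').
rewrite ?(innerC ms phis) ?(innerC m' m) ?(innerC ms m) ?(innerC ms m').
rewrite ?(innerC phi' phi) ?(innerC phis phi) ?(innerC phis phi').
lra.
Qed.

(** The shifted metric starts at [(m1, phi)], so the distance of [m1] and the first increment must
    be brought back to the initial point. The cross term of [m1 - ms] and [phi - phis] is absorbed
    by the square of their sum. *)
Lemma pd_first_step (R : realType) d N (m0 m1 ms phi phis : vfield R d N) :
  inner (m0 - 2^-1 *: phi - m1) (ms - m1) <= 0 ->
  inner phis ms <= inner phis m1 ->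
  normsq (m1 - ms) + 2 * normsq (m1 - m0)
    <= 2 * normsq (m0 - ms) + normsq (phi - phis).
Proof.
have := normsq_ge0 ((m1 - ms) + (phi - phis)).
rewrite /normsq !innerE.
rewrite ?(innerC m0 phi) ?(innerC m0 phis) ?(innerC m1 phi) ?(innerC m1 phis).
rewrite ?(innerC ms phi) ?(innerC ms phis) ?(innerC m1 m0) ?(innerC ms m0).
rewrite ?(innerC ms m1) ?(innerC phis phi).
lra.
Qed.

Lemma alg2_iterS (R : realType) d N (p : \bar R) (rho0 rho1 : d.-tuple R -> R)
    (y0 : state R d N) k :
  let s j := iter j (alg2_step p rho0 rho1) (y0, y0.2) in
  [/\ (s k.+1).1.1 = m_update rho0 rho1 (s k).1.1 (s k).2,
      (s k.+1).1.2 = phi_update p rho0 rho1 (s k.+1).1.1 (s k).1.2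
    & (s k.+1).2 = 2 *: (s k.+1).1.2 - (s k).1.2].
Proof. by rewrite /= /alg2_step; case: (iter _ _ _) => -[]. Qed.

(** The saddle point is the test point in the projection inequalities of both updates. The first
    conjunct stands apart because the initial extrapolation is [phi 0%N] itself. *)
Lemma alg2_iterateP (R : realType) d N (p : \bar R)
    (rho0 rho1 : d.-tuple R -> R) (y0 ys : state R d N) k :
  (0 < N)%N -> (1 <= p)%E -> Ystar p rho0 rho1 ys ->
  @feasible R d N rho0 rho1 !=set0 ->
  let m j := (alg2_iterate p rho0 rho1 y0 j).1 in
  let phi j := (alg2_iterate p rho0 rho1 y0 j).2 in
  [/\ inner (m 0%N - 2^-1 *: phi 0%N - m 1%N) (ys.1 - m 1%N) <= 0,
      inner (m k.+1 - 2^-1 *: (2 *: phi k.+1 - phi k) - m k.+2)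
        (ys.1 - m k.+2) <= 0,
      inner (phi k + 2^-1 *: m k.+1 - phi k.+1) (ys.2 - phi k.+1) <= 0,
      inner ys.2 ys.1 <= inner ys.2 (m k.+1)
    & inner (phi k.+1) ys.1 <= inner ys.2 ys.1].
Proof.
move=> N0 p1 Yys fne m phi; have [fys pys maxy miny] := saddleP p1 fne Yys.
pose s j := iter j (alg2_step p rho0 rho1) (y0, y0.2).
have mP j : feasible rho0 rho1 (m j.+1) /\
    inner (m j - 2^-1 *: (s j).2 - m j.+1) (ys.1 - m j.+1) <= 0.
  have [mE _ _] := alg2_iterS p rho0 rho1 y0 j; rewrite /m /alg2_iterate mE.
  have [fm obt] := m_updateP (s j).1.1 (s j).2 N0 fne.
  by split=> //; exact: obt.
have phiP j : polar p (phi j.+1) /\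
    inner (phi j + 2^-1 *: m j.+1 - phi j.+1) (ys.2 - phi j.+1) <= 0.
  have [_ phiE _] := alg2_iterS p rho0 rho1 y0 j.
  rewrite /phi /alg2_iterate phiE.
  have [fm _] := mP j.
  have [pphi obt] := phi_updateP (s j).1.2 N0 p1 fm.
  by split=> //; exact: obt.
split.
- exact: (mP 0%N).2.
- have [_ _ <-] := alg2_iterS p rho0 rho1 y0 k; exact: (mP k.+1).2.
- exact: (phiP k).2.
- exact: miny (mP k).1.
- exact: maxy (phiP k).1.
Qed.

Lemma sum_G_le (R : realType) d N (p : \bar R) (rho0 rho1 : d.-tuple R -> R)
    (y0 ys : state R d N) n :
  (0 < N)%N -> (1 <= p)%E -> Ystar p rho0 rho1 ys ->
  @feasible R d N rho0 rho1 !=set0 ->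
  \sum_(k < n) G_ p rho0 rho1 y0 k <= 30 * state_normsq (y0 - ys).
Proof.
move=> N0 p1 Yys fne.
have P k := alg2_iterateP y0 k N0 p1 Yys fne.
pose m j := (alg2_iterate p rho0 rho1 y0 j).1.
pose phi j := (alg2_iterate p rho0 rho1 y0 j).2.
pose q k := pd_normsq (m k.+1 - ys.1) (phi k - ys.2).
have GE k : G_ p rho0 rho1 y0 k = pd_normsq (m k.+1 - m k) (phi k.+1 - phi k).
  by rewrite /G_ /mu /tau invrK /pd_normsq /= !(mulrC 2).
have qstep k : normsq (m k.+2 - m k.+1) + normsq (phi k.+1 - phi k)
    <= q k - q k.+1.
  have [_ mk phik my phiy] := P k; apply: le_trans (pd_normsq_ge _ _) _.
  have [_ _ _ my' _] := P k.+1.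
  exact: pd_fejer.
(* [q] pairs [m k.+1] with [phi k], so increments of [m] run one index ahead; the extra term on the
   left carries the leading one, and the first one enters on the right. *)
have tele k : \sum_(j < k) (normsq (m j.+1 - m j) + normsq (phi j.+1 - phi j))
    + normsq (m k.+1 - m k) <= normsq (m 1%N - m 0%N) + (q 0%N - q k).
  elim: k => [|k IH]; first by rewrite big_ord0 subrr addr0 add0r.
  by rewrite big_ord_recr /=; have := qstep k; lra.
have [m1 _ _ my _] := P 0%N.
have first_le := pd_first_step m1 my.
rewrite -/(m 1%N) -/(m 0%N) -/(phi 0%N) in first_le.
have q0 : q 0%N <= 3 * (normsq (m 1%N - ys.1) + normsq (phi 0%N - ys.2)).
  exact: pd_normsq_le.
have qn : 0 <= q n.
  by apply: le_trans (pd_normsq_ge _ _); rewrite addr_ge0 ?normsq_ge0.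
have G3 : \sum_(k < n) G_ p rho0 rho1 y0 k <=
    3 * \sum_(j < n) (normsq (m j.+1 - m j) + normsq (phi j.+1 - phi j)).
  rewrite mulr_sumr; apply: ler_sum => k _; rewrite GE; exact: pd_normsq_le.
have -> : state_normsq (y0 - ys) =
  normsq (m 0%N - ys.1) + normsq (phi 0%N - ys.2) by [].
(* The sum is at most [3 * (D + 3 * (E + P))], with [D], [E], [P] the squared norms of
   [m 1%N - m 0%N], [m 1%N - ys.1], [phi 0%N - ys.2]; [first_le] turns this into a factor 18, within
   30. *)
have := tele n; have := normsq_ge0 (m n.+1 - m n).
have := normsq_ge0 (m 0%N - ys.1); have := normsq_ge0 (phi 0%N - ys.2).
have := normsq_ge0 (m 1%N - m 0%N); have := normsq_ge0 (m 1%N - ys.1).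
lra.
Qed.

(** Every residual before the stop is at least [eps], so the number of iterations times [eps] is at
    most the summed residual. The same count excludes a run without stop, for which [alg2_niter]
    would be 0 by convention. *)
Lemma alg2_niter_le (R : realType) d N (p : \bar R)
    (rho0 rho1 : d.-tuple R -> R) (y0 ys : state R d N) eps E :
  (0 < N)%N -> (1 <= p)%E -> Ystar p rho0 rho1 ys ->
  @feasible R d N rho0 rho1 !=set0 -> 0 < eps -> state_normsq (y0 - ys) <= E ->
  alg2_halts p rho0 rho1 y0 eps /\
  (alg2_niter p rho0 rho1 y0 eps)%:R <= 30 * E / eps.
Proof.
move=> N0 p1 Yys fne eps0 leE.
have sumG n : (forall k, (k < n)%N -> eps <= G_ p rho0 rho1 y0 k) ->
    n%:R <= 30 * E / eps.
  move=> Gge; rewrite ler_pdivlMr //.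
  apply: (@le_trans _ _ (\sum_(k < n) G_ p rho0 rho1 y0 k)); last first.
    apply: le_trans (sum_G_le y0 n N0 p1 Yys fne) _.
    by rewrite ler_pM2l // ltr0n.
  rewrite -[n in n%:R]card_ord mulr_natl -sumr_const.
  by apply: ler_sum => k _; exact: Gge.
have halts : alg2_halts p rho0 rho1 y0 eps.
  apply: contrapT => nohalt.
  have E0 : 0 <= 30 * E / eps.
    rewrite divr_ge0 ?(ltW eps0) // mulr_ge0 //; apply: le_trans leE.
    by rewrite addr_ge0 ?normsq_ge0.
  have /sumG : forall k, (k < Num.bound (30 * E / eps))%N ->
      eps <= G_ p rho0 rho1 y0 k.
    move=> k _; rewrite leNgt; apply/negP => Gk.
    by apply: nohalt; exists k.
  by rewrite leNgt archi_boundP.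
split=> //; apply: sumG => k; rewrite /alg2_niter; case: pselect => // h.
case: ex_minnP => n _ nmin kn; rewrite leNgt; apply/negP => Gk.
by have := nmin _ Gk; rewrite leqNgt kn.
Qed.

(** * Interpolation: sizes of stencils and boundedness in L^2 *)

Lemma stencil_window (R : realType) d N (x : grid d (2 * N)) (y : grid d N)
    i j :
  (0 < N)%N -> y \in stencil R N i x ->
  (x j <= (2 * y j).+1)%N /\ (2 * y j <= (x j).+1)%N.
Proof.
move=> N0 ys.
have : y \in neighbors R N x.
  by move: ys; rewrite /stencil; case: ifP => // _; rewrite inE => /andP[].
have N2 : 0 < (2 * N)%:R :> R by rewrite ltr0n muln_gt0.
have NR : 0 < N%:R :> R by rewrite ltr0n.
rewrite inE => /forallP/(_ j).
(* In units of the fine step a coarse coordinate is the even integer [2 * y j], and adjacency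
   becomes an integer inequality. *)
have -> : Defs.coord R y j = (2 * y j)%:R / (2 * N)%:R.
  by rewrite /Defs.coord /step !natrM -mulf_div divff ?mul1r ?pnatr_eq0.
rewrite /Defs.coord /step; case: ifP => _ => [/eqP/divIf|].
  by move=> /(_ (lt0r_neq0 N2))/eqP; rewrite eqr_nat => /eqP <-; split; lia.
rewrite -mulrBl normrM (gtr0_norm (x := _^-1)) ?invr_gt0 //.
rewrite -[leRHS]mul1r ler_pM2r ?invr_gt0 // ler_norml => /andP[lo hi].
by split; rewrite -(ler_nat R) -natr1; lra.
Qed.

(** In each coordinate [2 * y j] is an even number within 1 of [x j], hence determined by the bit
    [x j < 2 * y j]. *)
Lemma card_stencil_le (R : realType) d N (x : grid d (2 * N)) i :
  (0 < N)%N -> (#|stencil R N i x| <= 2 ^ d)%N.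
Proof.
move=> N0.
pose side (y : grid d N) : {ffun 'I_d -> bool} := [ffun j => x j < 2 * y j]%N.
have side_inj : {in stencil R N i x &, injective side}.
  move=> y z ys zs /ffunP eq_side; apply/ffunP => j; apply/val_inj => /=.
  have := eq_side j; rewrite !ffunE.
  have := stencil_window j N0 ys; have := stencil_window j N0 zs.
  by case: ltnP; case: ltnP => //; lia.
rewrite -(card_in_imset side_inj); apply: leq_trans (max_card _) _.
by rewrite card_ffun card_bool card_ord.
Qed.

(** For fixed [y] each [x j] takes one of three values around [2 * y j]. This bounds how often
    interpolation uses a coarse value. *)
Lemma card_stencil_dual_le (R : realType) d N (y : grid d N) i :
  (0 < N)%N -> (#|[set x : grid d (2 * N) | y \in stencil R N i x]| <= 3 ^ d)%N.
Proof.
move=> N0.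
pose offset (x : grid d (2 * N)) : {ffun 'I_d -> 'I_3} :=
  [ffun j => inord ((x j).+1 - 2 * y j)].
have offset_inj :
    {in [set x : grid d (2 * N) | y \in stencil R N i x] &, injective offset}.
  move=> x z; rewrite !inE => xs zs /ffunP eq_off; apply/ffunP => j.
  apply/val_inj => /=; have := congr1 val (eq_off j); rewrite !ffunE /=.
  have := stencil_window j N0 xs; have := stencil_window j N0 zs => wz wx.
  by rewrite !inordK; lia.
rewrite -(card_in_imset offset_inj); apply: leq_trans (max_card _) _.
by rewrite card_ffun !card_ord.
Qed.

(** The squared deviations from the mean have a nonnegative sum. For empty [S] the left side is 0,
    division by zero giving 0. *)
Lemma sqr_average_le (R : realType) (T : finType) (S : {set T}) (a : T -> R) :
  ((\sum_(y in S) a y) / #|S|%:R) ^+ 2 <= \sum_(y in S) a y ^+ 2.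
Proof.
have [S0|S0] := posnP #|S|.
  rewrite S0 invr0 mulr0 expr0n /=.
  by apply: sumr_ge0 => y _; exact: sqr_ge0.
have n0 : 0 < #|S|%:R :> R by rewrite ltr0n.
have n1 : 1 <= #|S|%:R :> R by rewrite ler1n.
set c := (\sum_(y in S) a y) / #|S|%:R.
have sc : \sum_(y in S) a y = c * #|S|%:R by rewrite divfK ?gt_eqF.
have : 0 <= \sum_(y in S) (a y - c) ^+ 2.
  by apply: sumr_ge0 => y _; exact: sqr_ge0.
have -> : \sum_(y in S) (a y - c) ^+ 2
    = \sum_(y in S) a y ^+ 2 - #|S|%:R * c ^+ 2.
  transitivity (\sum_(y in S) (a y ^+ 2 + (- 2 * c) * a y + c ^+ 2)).
    by apply: eq_bigr => y _; ring.
  by rewrite !big_split /= -mulr_sumr sc sumr_const -mulr_natl; ring.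
rewrite subr_ge0; apply: le_trans.
by rewrite -[leLHS]mul1r ler_wpM2r // sqr_ge0.
Qed.

(** After squared averages are replaced by sums of squares and the sums exchanged, each coarse value
    occurs at most [3 ^ d] times; fine cells have no larger volume than coarse ones. *)
Lemma normsq_interpolate_field_le (R : realType) d N (u : vfield R d N) :
  (0 < N)%N -> normsq (interpolate_field (2 * N) u) <= 3 ^+ d * normsq u.
Proof.
move=> N0; have h0 : 0 <= step R (2 * N) ^+ d.
  by rewrite exprn_ge0 // invr_ge0 ler0n.
have hh : step R (2 * N) ^+ d <= step R N ^+ d.
  rewrite lerXn2r ?nnegrE ?invr_ge0 ?ler0n //.
  by rewrite lef_pV2 ?posrE ?ltr0n ?muln_gt0 // ler_nat leq_pmull.
rewrite /normsq /inner -!mulr_suml mulrA; apply: ler_pM => //.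
  by apply: sumr_ge0 => x _; apply: sumr_ge0 => i _; rewrite -expr2 sqr_ge0.
apply: (@le_trans _ _ (\sum_(x : grid d (2 * N)) \sum_(i < d)
    \sum_(y in stencil R N i x) u y 0 i ^+ 2)).
  apply: ler_sum => x _; apply: ler_sum => i _.
  by rewrite ffunE mxE -expr2 sqr_average_le.
rewrite exchange_big [in leRHS]exchange_big /= mulr_sumr.
apply: ler_sum => i _; rewrite mulr_sumr.
rewrite (exchange_big_dep xpredT) //=; apply: ler_sum => y _.
rewrite sumr_const -expr2 -[leLHS]mulr_natl ler_wpM2r ?sqr_ge0 //.
rewrite -natrX ler_nat; apply: leq_trans (card_stencil_dual_le R y i N0).
by apply: subset_leq_card; apply/fintype.subsetP => x xs; rewrite inE.
Qed.

Lemma interpolate_fieldB (R : realType) d N N' (u v : vfield R d N) :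
  interpolate_field N' (u - v) =
    interpolate_field N' u - interpolate_field N' v.
Proof.
apply/ffunP => x; apply/rowP => i; rewrite !ffunE !mxE -mulrBl -sumrB.
by congr (_ / _); apply: eq_bigr => y _; rewrite !ffunE !mxE.
Qed.

Lemma state_normsq_interpolate_le (R : realType) d N N' (y z : state R d N) :
  (0 < N)%N -> N' = (2 * N)%N ->
  state_normsq (interpolate N' y - interpolate N' z)
    <= 3 ^+ d * state_normsq (y - z).
Proof.
move=> N0 ->; rewrite /state_normsq /= -!interpolate_fieldB mulrDr.
by apply: lerD; exact: normsq_interpolate_field_le.
Qed.

Lemma state_normsqD_le (R : realType) d N (y z : state R d N) :
  state_normsq (y + z) <= 2 * state_normsq y + 2 * state_normsq z.
Proof.
have := normsqD_le y.1 z.1; have := normsqD_le y.2 z.2.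
rewrite /state_normsq /=; lra.
Qed.

Lemma interp_ops_le (R : realType) d N N' :
  (0 < N)%N -> N' = (2 * N)%N ->
  (interp_ops R d N N' <= 2 ^ d.+1 * (d * npts d N'))%N.
Proof.
move=> N0 ->; rewrite /interp_ops expnS -mulnA leq_mul2l /=.
apply: (@leq_trans (\sum_(x : grid d (2 * N)) \sum_(i < d) 2 ^ d)%N).
  by apply: leq_sum => x _; apply: leq_sum => i _; exact: card_stencil_le.
rewrite !sum_nat_const card_ord -/(npts _ _); lia.
Qed.

(** * Geometric sums over the levels *)

Lemma step_powR (R : realType) l : step R (gridN l.+1) = 2 `^ (- l%:R).
Proof. by rewrite /step /gridN natrX powRN powR_mulrn. Qed.

(** The terms are powers of [r]: the last dominates if [beta < 0], the first if [beta > 0], and for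
    [beta = 0] all [L] terms are 1. *)
Lemma geometric_sum_le (R : realType) (beta : R) : exists2 Cg : R, 0 < Cg &
  forall L, (1 < L)%N ->
  let h := step R (gridN L) in
  let S := \sum_(1 <= l < L.+1) step R (gridN l) `^ beta in
  [/\ beta < 0 -> S <= Cg * h `^ beta, beta = 0 -> S <= Cg * ln h^-1
    & 0 < beta -> S <= Cg].
Proof.
have ln2 : 0 < ln 2 :> R by rewrite ln_gt0 // ltr1n.
pose r : R := 2 `^ (- beta).
have r0 : 0 < r by rewrite powR_gt0.
have hE l : step R (gridN l.+1) `^ beta = r ^+ l.
  rewrite step_powR -powRrM -powR_mulrn ?powR_ge0 // /r -powRrM.
  by congr (_ `^ _); ring.
have SE L : \sum_(1 <= l < L.+1) step R (gridN l) `^ beta = \sum_(i < L) r ^+ i.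
  by rewrite big_add1 big_mkord; apply: eq_bigr => i _; exact: hE.
have geo L : (r - 1) * \sum_(i < L) r ^+ i = r ^+ L - 1 by rewrite subrX1.
have [b0|b0|b0] := ltgtP beta 0.
- have r1 : 1 < r by rewrite /r /powR pnatr_eq0 /= expR_gt1; nra.
  exists (r / (r - 1)); first by rewrite divr_gt0 // subr_gt0.
  case=> // L _ h S; split=> [_|b0'|b0']; [|lra|lra].
  rewrite /S SE /h hE -mulrAC -exprS ler_pdivlMr ?subr_gt0 // mulrC geo.
  by rewrite lerBlDr lerDl.
- have r1 : r < 1 by rewrite /r /powR pnatr_eq0 /= expR_lt1; nra.
  exists (1 - r)^-1; first by rewrite invr_gt0 subr_gt0.
  move=> L _ h S; split=> [b0'|b0'|_]; [lra|lra|].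
  rewrite -[_^-1]mul1r ler_pdivlMr ?subr_gt0 // /S SE.
  have -> : (\sum_(i < L) r ^+ i) * (1 - r) = 1 - r ^+ L.
    by rewrite -opprB mulrN mulrC geo opprB.
  by rewrite lerBlDr lerDl exprn_ge0 // ltW.
(* [L = 1 + log2 (1 / h)] is at most twice [log2 (1 / h)], which is at least 1 from two levels
   on. *)
- exists (2 / ln 2); first by rewrite divr_gt0.
  move=> L L1 h S; split=> [b0'|_|b0']; [lra| |lra].
  have r1 : r = 1 by rewrite /r b0 oppr0 powRr0.
  rewrite /S SE r1 (eq_bigr (fun=> 1)) => [|i _]; last by rewrite expr1n.
  rewrite sumr_const card_ord (gridN_log2 R (ltnW L1)) -/h.
  have le1 : 1 <= ln h^-1 / ln 2.
    rewrite ler_pdivlMr // mul1r /h /step invrK.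
    rewrite ler_ln ?posrE ?ltr0n ?expn_gt0 //.
    by rewrite ler_nat /gridN -{1}[2%N]expn1 leq_exp2l // -ltnS prednK // ltnW.
  by rewrite (mulrAC 2) -mulrA; lra.
Qed.

(** * Operation counts *)

Lemma npts_le (R : realType) d N :
  (0 < N)%N -> (npts d N)%:R <= 2 ^+ d * N%:R ^+ d :> R.
Proof.
move=> N0; rewrite /npts card_ffun !card_ord natrX -exprMn -natrM.
by rewrite lerXn2r ?nnegrE ?ler0n // ler_nat; lia.
Qed.

Lemma A_ops_le d N : (0 < d)%N -> (A_ops d N <= 3 * (d * npts d N))%N.
Proof.
move=> d0; apply: (@leq_trans (\sum_(x : grid d N) 3 * d)%N); last first.
  by rewrite sum_nat_const -/(npts d N); lia.
apply: leq_sum => x _.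
apply: (@leq_trans (\sum_(i < d) 2 + d.-1)%N).
  by rewrite leq_add2r; apply: leq_sum => i _; case: ifP.
by rewrite sum_nat_const card_ord; lia.
Qed.

Lemma A_adj_ops_le d N : (A_adj_ops d N <= 2 * (d * npts d N))%N.
Proof.
apply: (@leq_trans (\sum_(x : grid d N) \sum_(i < d) 2)%N); last first.
  by rewrite !sum_nat_const card_ord -/(npts d N); lia.
by apply: leq_sum => x _; apply: leq_sum => i _; case: ifP.
Qed.

Lemma iter_ops_le_nat fft_ops prox_ops d N : (0 < d)%N ->
  (iter_ops fft_ops prox_ops d N
     <= 27 * (d * npts d N) + 2 * fft_ops N.+1 + npts d N * prox_ops d)%N.
Proof.
move=> d0; have P0 : (0 < npts d N)%N.
  by rewrite /npts card_ffun card_ord expn_gt0.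
(* In multiples of [d * npts d N]: 10 for the [m] update besides the transforms, 2 for [phi] besides
   the proximal operator, 2 for the extrapolation, 8 for [G_], and 5 absorbing its additive
   constant. *)
rewrite /iter_ops /m_update_ops /phi_update_ops /G_ops.
have := A_ops_le N d0; have := A_adj_ops_le d N.
have : (npts d N <= d * npts d N)%N by rewrite leq_pmull.
lia.
Qed.

(** The logarithm is that of the finest grid, because [ln N] vanishes on the coarsest one, where
    [N = 1]. Terms without logarithm are absorbed through [ln Nmax >= ln 2], whence the division by
    [ln 2]. *)
Lemma iter_ops_le (R : realType) (c_fft c_prox : R) fft_ops prox_ops d N Nmax :
  (0 < d)%N -> (0 < N)%N -> (N <= Nmax)%N -> (1 < Nmax)%N ->
  (forall n, (1 < n)%N ->
     (fft_ops n)%:R <= c_fft * ((n ^ d)%:R * ln (n ^ d)%:R)) ->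
  (forall n, (prox_ops n)%:R <= c_prox * n%:R) ->
  (iter_ops fft_ops prox_ops d N)%:R
    <= 2 ^+ d * ((27 + `|c_prox|) / ln 2 + 4 * `|c_fft|)
       * (d%:R * N%:R ^+ d) * ln Nmax%:R.
Proof.
move=> d0 N0 NN M1 fftP proxP.
have ln2 : 0 < ln 2 :> R by rewrite ln_gt0 // ltr1n.
have M0 : (0 < Nmax)%N by exact: ltnW.
have lnM : ln 2 <= ln Nmax%:R :> R by rewrite ler_ln ?posrE ?ltr0n // ler_nat.
have lnN : ln N.+1%:R <= 2 * ln Nmax%:R :> R.
  rewrite mulr_natl -lnXn ?ltr0n // ler_ln ?posrE ?exprn_gt0 ?ltr0n //.
  by rewrite -natrX ler_nat; nia.
have lnN0 : 0 <= ln N.+1%:R :> R by rewrite ln_ge0 // ler1n.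
set P : R := 2 ^+ d * N%:R ^+ d.
have Ple : (npts d N)%:R <= P by exact: npts_le.
have nptsE : npts d N = (N.+1 ^ d)%N by rewrite /npts card_ffun !card_ord.
have fftle : (fft_ops N.+1)%:R <= `|c_fft| * (P * (d%:R * (2 * ln Nmax%:R))).
  apply: le_trans (fftP _ _) _; first by rewrite ltnS.
  rewrite -nptsE; apply: le_trans (ler_norm _) _; rewrite normrM.
  rewrite ler_wpM2l // ger0_norm; last first.
    by rewrite mulr_ge0 // ln_ge0 // ler1n nptsE expn_gt0.
  apply: ler_pM => //; first by rewrite ln_ge0 // ler1n nptsE expn_gt0.
  rewrite nptsE natrX lnXn ?ltr0n // -[leLHS]mulr_natl.
  by apply: ler_wpM2l.
have proxle : (prox_ops d)%:R <= `|c_prox| * d%:R :> R.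
  by apply: le_trans (proxP d) _; rewrite ler_wpM2r // ler_norm.
apply: (@le_trans _ _ (27 * (d%:R * P)
    + 2 * (`|c_fft| * (P * (d%:R * (2 * ln Nmax%:R))))
    + P * (`|c_prox| * d%:R))).
  have := iter_ops_le_nat fft_ops prox_ops N d0.
  rewrite -(ler_nat R) 2!natrD !natrM => /le_trans; apply.
  have P0 : 0 <= P by apply: le_trans Ple; rewrite ler0n.
  apply: lerD; first apply: lerD.
  - by apply: ler_wpM2l => //; apply: ler_wpM2l.
  - exact: ler_wpM2l.
  - exact: ler_pM.
have -> : 2 ^+ d * ((27 + `|c_prox|) / ln 2 + 4 * `|c_fft|)
       * (d%:R * N%:R ^+ d) * ln Nmax%:R
  = (27 + `|c_prox|) * (d%:R * P) * (ln Nmax%:R / ln 2)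
    + 4 * `|c_fft| * (d%:R * P) * ln Nmax%:R by rewrite /P; ring.
have dP0 : 0 <= d%:R * P by rewrite mulr_ge0 // mulr_ge0 // exprn_ge0.
have le1 : 1 <= ln Nmax%:R / ln 2 :> R by rewrite ler_pdivlMr // mul1r.
have : (27 + `|c_prox|) * (d%:R * P)
    <= (27 + `|c_prox|) * (d%:R * P) * (ln Nmax%:R / ln 2).
  by rewrite ler_peMr // mulr_ge0 // addr_ge0.
lra.
Qed.

(** As [d >= 1], each term is at least twice the previous one. *)
Lemma sum_gridN_exp_le d L : (0 < d)%N ->
  (\sum_(2 <= l < L.+1) gridN l ^ d <= 2 * gridN L ^ d)%N.
Proof.
move=> d0; elim: L => [|[|L] IH]; [by rewrite big_geq|by rewrite big_geq|].
rewrite big_nat_recr //= [in leqRHS]mul2n -addnn leq_add2r.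
apply: leq_trans IH _; rewrite /gridN /= expnS expnMn leq_mul2r.
by rewrite -[leqLHS]expn1 leq_exp2l // d0 orbT.
Qed.

(** * Total cost of the two algorithms *)

Lemma alg2_cost_le (R : realType) fft_ops prox_ops d N (p : \bar R)
    (rho0 rho1 : d.-tuple R -> R) (y0 ys : state R d N) eps E I :
  (0 < N)%N -> (1 <= p)%E -> Ystar p rho0 rho1 ys ->
  @feasible R d N rho0 rho1 !=set0 -> 0 < eps -> state_normsq (y0 - ys) <= E ->
  (iter_ops fft_ops prox_ops d N)%:R <= I ->
  (alg2_cost fft_ops prox_ops p rho0 rho1 y0 eps <= (30 * E / eps * I)%:E)%E.
Proof.
move=> N0 p1 Yys fne eps0 leE leI.
have [halts niter] := alg2_niter_le N0 p1 Yys fne eps0 leE.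
by rewrite /alg2_cost asboolT // lee_fin natrM ler_pM.
Qed.

Lemma gridN_gt0 l : (0 < gridN l)%N.
Proof. by rewrite /gridN expn_gt0. Qed.

Lemma gridNS l : (0 < l)%N -> gridN l.+1 = (2 * gridN l)%N.
Proof. by case: l => // l _; rewrite /gridN /= expnS. Qed.

Lemma step_gridNS_powR (R : realType) (nu : R) l : (0 < l)%N ->
  step R (gridN l) `^ nu = 2 `^ nu * step R (gridN l.+1) `^ nu.
Proof.
move=> l0; rewrite -powRM ?invr_ge0 ?ler0n //; congr (_ `^ _).
by rewrite /step gridNS // natrM invfM mulrA divff ?mul1r // pnatr_eq0.
Qed.

(** At level 1 the step is 1 and the start is 0, so [|C3|] suffices. Later, [2 * 3 ^+ d * C4] comes
    from interpolating the previous error, [2 * C4] from interpolating the saddle point, and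
    [2 ^ nu] from passing to the finer step. *)
Lemma alg2M_start_near_saddle (R : realType) d (p : \bar R)
    (rho0 rho1 : d.-tuple R -> R) (nu C3 C4 : R) L (eps : nat -> R) :
  let Y l : set (state R d (gridN l)) := Ystar p rho0 rho1 in
  0 < C4 ->
  (forall l, (1 <= l <= L)%N ->
     Y l !=set0 /\ (forall y, Y l y -> state_normsq y <= C3)) ->
  (forall l, (1 <= l < L)%N -> forall y, Y l y ->
     exists2 y', Y l.+1 y' &
       state_normsq (interpolate (gridN l.+1) y - y')
         <= C4 * step R (gridN l) `^ nu) ->
  T2M p rho0 rho1 C4 nu L eps ->
  forall l, (1 <= l <= L)%N -> exists2 y, Y l y &
    state_normsq (alg2M_start p rho0 rho1 eps l - y)
      <= (`|C3| + (2 * 3 ^+ d * C4 + 2 * C4) * 2 `^ nu)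
         * step R (gridN l) `^ nu.
Proof.
move=> Y C40 bndY interpY epsT [|[|l]] // /andP[_ lL].
  have [[y Yy] /(_ y Yy) yC3] := bndY 1%N lL.
  exists y => //; rewrite /step /gridN /= invr1 powR1 mulr1 sub0r.
  have -> : state_normsq (- y) = state_normsq y.
    by rewrite /state_normsq /normsq /= !(innerNl, innerNr) !opprK.
  apply: le_trans yC3 _; apply: le_trans (ler_norm _) _; rewrite lerDl.
  by rewrite mulr_ge0 ?powR_ge0 // addr_ge0 // !mulr_ge0 ?exprn_ge0 // ltW.
have lL' : (0 < l.+1 <= L)%N := ltnW lL.
have [eps0 [t [t0 tP] le_t]] := epsT l.+1 lL'.
have [|y Yy outy] := tP (eps l.+1); first by rewrite eps0.
have [y' Yy' yy'] := interpY l.+1 lL y Yy.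
exists y' => //.
pose out := alg2_out p rho0 rho1 (alg2M_start p rho0 rho1 eps l.+1) (eps l.+1).
have -> : alg2M_start p rho0 rho1 eps l.+2 - y' =
    (interpolate (gridN l.+2) out - interpolate (gridN l.+2) y)
    + (interpolate (gridN l.+2) y - y') by rewrite addrA subrK.
apply: le_trans (state_normsqD_le _ _) _.
rewrite [leRHS]mulrDl -(mulrA _ (2 `^ nu)) -(@step_gridNS_powR R nu l.+1) //.
have := state_normsq_interpolate_le out y (gridN_gt0 l.+1) (gridNS (ltn0Sn l)).
have : 3 ^+ d * state_normsq (out - y)
    <= 3 ^+ d * (C4 * step R (gridN l.+1) `^ nu).
  by rewrite ler_wpM2l // exprn_ge0.
have : 0 <= `|C3| * step R (gridN l.+2) `^ nu by rewrite mulr_ge0 ?powR_ge0.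
nra.
Qed.

(** The factors are [2 ^ d.+1] per component for both fields, [2 ^ d] from [N + 1 <= 2 * N] points
    per side, and 2 from the geometric sum over levels. *)
Lemma interp_total_le (R : realType) d L : (0 < d)%N ->
  (\sum_(2 <= l < L.+1) interp_ops R d (gridN l.-1) (gridN l))%N%:R
    <= 4 * 2 ^+ d * (d%:R * 2 ^+ d / step R (gridN L) ^+ d) :> R.
Proof.
move=> d0; rewrite natr_sum.
apply: (@le_trans _ _ (\sum_(2 <= l < L.+1)
    2 ^+ d.+1 * (d%:R * (2 ^+ d * (gridN l ^ d)%:R)))).
  rewrite big_nat [leRHS]big_nat; apply: ler_sum => -[|[|l]] // _.
  have := interp_ops_le R d (gridN_gt0 l.+1) (gridNS (ltn0Sn l)).
  rewrite -(ler_nat R) /= => /le_trans; apply.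
  rewrite !natrM natrX ler_wpM2l ?exprn_ge0 // ler_wpM2l //.
  by rewrite natrX npts_le // gridN_gt0.
rewrite -!mulr_sumr -natr_sum /step exprVn invrK.
have := sum_gridN_exp_le L d0; rewrite -(ler_nat R) natrM natrX => le_sum.
have -> : 4 * 2 ^+ d * (d%:R * 2 ^+ d * (gridN L)%:R ^+ d) =
    2 ^+ d.+1 * (d%:R * (2 ^+ d * (2 * (gridN L)%:R ^+ d))) :> R.
  by rewrite exprS; ring.
by do 3![apply: ler_wpM2l; rewrite ?mulr_ge0 ?exprn_ge0 //].
Qed.

(* The powers of [h_l] in the iteration bound [30 B h_l^nu / eps_l] and in the
   cost of an iteration collect to the exponent [nu - d - alpha], whose sign
   decides which level dominates. *)
Lemma complexity2M_le (R : realType) fft_ops prox_ops d (p : \bar R)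
    (rho0 rho1 : d.-tuple R -> R) (alpha nu B Ci : R) L (eps : nat -> R) :
  let h := step R (gridN L) in
  let Y l : set (state R d (gridN l)) := Ystar p rho0 rho1 in
  (0 < d)%N -> (1 <= p)%E ->
  (forall l, (1 <= l <= L)%N -> @feasible R d (gridN l) rho0 rho1 !=set0) ->
  (forall l, (1 <= l <= L)%N -> exists2 y, Y l y &
    state_normsq (alg2M_start p rho0 rho1 eps l - y)
      <= B * step R (gridN l) `^ nu) ->
  (forall l, (1 <= l <= L)%N -> (iter_ops fft_ops prox_ops d (gridN l))%:R
     <= Ci * (d%:R * (gridN l)%:R ^+ d) * ln h^-1) ->
  (forall l, (1 <= l <= L)%N ->
     0 < eps l /\ eps l = eps L * (step R (gridN l) / h) `^ alpha) ->
  (complexity2M fft_ops prox_ops p rho0 rho1 L eps <=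
     (30 * B * Ci * ((eps L)^-1 * d%:R * ln h^-1 * h `^ alpha
        * \sum_(1 <= l < L.+1) step R (gridN l) `^ (nu - d%:R - alpha))
      + 4 * 2 ^+ d * (d%:R * 2 ^+ d / h ^+ d))%:E)%E.
Proof.
move=> h Y d0 p1 fne near iterP epsP.
rewrite EFinD; apply: leeD; last by rewrite lee_fin interp_total_le.
rewrite !mulr_sumr -sumEFin big_nat [leRHS]big_nat; apply: lee_sum => l lL.
have lL' : (1 <= l <= L)%N by move: lL; rewrite ltnS.
have [y Yy le_y] := near l lL'; have [eps0 epsE] := epsP l lL'.
apply: le_trans (alg2_cost_le (gridN_gt0 l) p1 Yy (fne l lL') eps0 le_y
  (iterP l lL')) _.
rewrite lee_fin le_eqVlt; apply/orP; left; apply/eqP.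
have h0 : 0 < h by rewrite step_gt0 // gridN_gt0.
have hl0 : 0 < step R (gridN l) by rewrite step_gt0 // gridN_gt0.
have ratioE : (step R (gridN l) / h) `^ alpha
    = step R (gridN l) `^ alpha / h `^ alpha.
  rewrite powRM ?invr_ge0 ?(ltW hl0) ?(ltW h0) // -(powR_inv1 (ltW h0)).
  by rewrite -powRrM mulN1r powRN.
have powE : step R (gridN l) `^ (nu - d%:R - alpha)
    = step R (gridN l) `^ nu / step R (gridN l) ^+ d
      / step R (gridN l) `^ alpha.
  by rewrite !powRB ?(gt_eqF hl0) ?implybT // powR_mulrn // ltW.
have gridE : (gridN l)%:R = (step R (gridN l))^-1 by rewrite /step invrK.
by rewrite epsE ratioE powE gridE exprVn !invfM !invrK; ring.
Qed.

Theorem theorem4p6 (R : realType) (d : nat) (p : \bar R)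
    (alpha nu C3 C4 c_fft c_prox : R) :
  (0 < d)%N -> (1 <= p)%E -> 0 < nu -> 0 < C4 ->
  exists2 C : R, 0 < C &
  exists L0 : nat, forall L : nat, (L0 <= L)%N ->
  forall (fft_ops prox_ops : nat -> nat) (rho0 rho1 : d.-tuple R -> R),
  let h : R := step R (gridN L) in
  let h_ (l : nat) : R := step R (gridN l) in
  let Y (l : nat) : set (state R d (gridN l)) := Ystar p rho0 rho1 in
  (* cost of a d-dimensional FFT with n points per side, and of the proximal
     operator in dimension n *)
  (forall n, (1 < n)%N ->
     (fft_ops n)%:R <= c_fft * ((n ^ d)%:R * ln (n ^ d)%:R)) ->
  (forall n, (prox_ops n)%:R <= c_prox * n%:R) ->
  is_density rho0 -> is_density rho1 ->
  (forall l, (1 <= l <= L)%N ->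
     Y l !=set0 /\ (forall y, Y l y -> state_normsq y <= C3)) ->
  (forall l, (1 <= l < L)%N -> forall y, Y l y ->
     exists2 y', Y l.+1 y' &
       state_normsq (interpolate (gridN l.+1) y - y') <= C4 * h_ l `^ nu) ->
  (forall eps, T2 (gridN L) p rho0 rho1 C4 nu eps ->
     (complexity2 fft_ops prox_ops (gridN L) p rho0 rho1 eps
      <= (C * (eps^-1 * (d%:R / h ^+ d) * ln h^-1))%:E)%E) /\
  (forall eps : nat -> R, T2M p rho0 rho1 C4 nu L eps ->
     (forall l, (1 <= l <= L)%N -> eps l = eps L * (h_ l / h) `^ alpha) ->
     let cost := complexity2M fft_ops prox_ops p rho0 rho1 L eps in
     let interp := d%:R * 2 ^+ d / h ^+ d in
     [/\ nu - d%:R < alpha ->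
           (cost <= (C * ((eps L)^-1 * (d%:R / h `^ (d%:R - nu)) * ln h^-1)
                     + C * interp)%:E)%E,
         alpha = nu - d%:R ->
           (cost <= (C * ((eps L)^-1 * (d%:R / h `^ (d%:R - nu)) * ln h^-1 ^+ 2)
                     + C * interp)%:E)%E
       & alpha < nu - d%:R ->
           (cost <= (C * ((eps L)^-1 * (d%:R / h `^ (- alpha)) * ln h^-1)
                     + C * interp)%:E)%E]).
Proof.
move=> d0 p1 nu0 C40.
pose Ci : R := 2 ^+ d * ((27 + `|c_prox|) / ln 2 + 4 * `|c_fft|).
pose B : R := `|C3| + (2 * 3 ^+ d * C4 + 2 * C4) * 2 `^ nu.
have [Cg Cg0 geo] := geometric_sum_le (nu - d%:R - alpha).
have ln2 : 0 < ln 2 :> R by rewrite ln_gt0 // ltr1n.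
have Ci0 : 0 <= Ci.
  apply: mulr_ge0; [exact: exprn_ge0|apply: addr_ge0; last exact: mulr_ge0].
  by apply: divr_ge0; [exact: addr_ge0|exact: ltW].
have BC3 : `|C3| <= B.
  rewrite lerDl mulr_ge0 ?powR_ge0 // addr_ge0 // !mulr_ge0 ?exprn_ge0 //;
  exact: ltW.
have B0 : 0 <= B by apply: le_trans BC3.
have BCi0 : 0 <= 30 * B * Ci by apply: mulr_ge0 => //; exact: mulr_ge0.
have p20 : 0 <= 4 * 2 ^+ d :> R by rewrite mulr_ge0 // exprn_ge0.
(* Collects the iteration constant, the same times [Cg], and the interpolation constant; the final 1
   makes [C] positive. *)
pose C : R := 30 * B * Ci * (1 + Cg) + 4 * 2 ^+ d + 1.
have [BCiCg0 C_def] : 0 <= 30 * B * Ci * Cg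
    /\ C = 30 * B * Ci + 30 * B * Ci * Cg + 4 * 2 ^+ d + 1.
  by split; [exact: mulr_ge0 BCi0 (ltW Cg0)|rewrite /C mulrDr mulr1].
have leC1 : 30 * B * Ci <= C by rewrite C_def; move: BCi0 BCiCg0 p20; lra.
have leCg : 30 * B * Ci * Cg <= C by rewrite C_def; move: BCi0 BCiCg0 p20; lra.
have leC2 : 4 * 2 ^+ d <= C by rewrite C_def; move: BCi0 BCiCg0 p20; lra.
have C0 : 0 < C by rewrite C_def; move: BCi0 BCiCg0 p20; lra.
exists C => //; exists 2%N => L L1 fft_ops prox_ops rho0 rho1 h h_ Y.
move=> fftP proxP _ _ bndY interpY.
have [geo_lt geo_eq geo_gt] := geo L L1.
have h0 : 0 < h by rewrite step_gt0 // gridN_gt0.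
have L0 : (0 < L)%N by exact: ltnW.
have gridL1 : (1 < gridN L)%N.
  by rewrite /gridN -[1%N](expn0 2) ltn_exp2l // -ltnS prednK.
have hE : h^-1 = (gridN L)%:R by rewrite /h /step invrK.
have lnh0 : 0 <= ln h^-1 by rewrite hE ln_ge0 // ler1n ltnW.
(* Solvability of the constraint comes from the bound on the saddle set. *)
have fne l : (1 <= l <= L)%N -> @feasible R d (gridN l) rho0 rho1 !=set0.
  by move=> /bndY[_]; exact: bounded_saddle_feasible (gridN_gt0 l) p1.
have iterP l : (1 <= l <= L)%N -> (iter_ops fft_ops prox_ops d (gridN l))%:R
    <= Ci * (d%:R * (gridN l)%:R ^+ d) * ln h^-1.
  case/andP=> l0 lL; rewrite hE; apply: iter_ops_le; rewrite ?gridN_gt0 //.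
  by rewrite /gridN leq_exp2l // -!subn1 leq_sub2r.
have LL : (1 <= L <= L)%N by rewrite L0 leqnn.
split=> [eps [eps0 _]|eps epsT epsE cost interp].
  have [[y Yy] /(_ y Yy) yC3] := bndY L LL.
  have leE : state_normsq (0 - y) <= `|C3|.
    rewrite sub0r; apply: le_trans (ler_norm _); apply: le_trans yC3.
    by rewrite /state_normsq /normsq /= !(innerNl, innerNr) !opprK.
  apply: le_trans (alg2_cost_le (gridN_gt0 L) p1 Yy (fne L LL) eps0 leE
    (iterP L LL)) _.
  rewrite lee_fin -hE exprVn.
  set t := eps^-1 * (d%:R / h ^+ d) * ln h^-1.
  have t0 : 0 <= t.
    rewrite mulr_ge0 // mulr_ge0 ?invr_ge0 ?(ltW eps0) //.
    by rewrite divr_ge0 // exprn_ge0 // ltW.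
  have -> : 30 * `|C3| / eps * (Ci * (d%:R / h ^+ d) * ln h^-1)
      = 30 * `|C3| * Ci * t by rewrite /t; ring.
  apply: le_trans (_ : 30 * B * Ci * t <= _); last by rewrite ler_wpM2r.
  by do 2![apply: ler_wpM2r => //]; rewrite ler_pM2l.
have near := alg2M_start_near_saddle C40 bndY interpY epsT.
have epsP l : (1 <= l <= L)%N ->
    0 < eps l /\ eps l = eps L * (step R (gridN l) / h) `^ alpha.
  by move=> lL; split; [exact: (epsT l lL).1|exact: epsE].
have := complexity2M_le d0 p1 fne near iterP epsP; rewrite -/h -/cost.
set S := \sum_(1 <= l < L.+1) _ in geo_lt geo_eq geo_gt *.
have epsL0 : 0 < eps L := (epsP L LL).1.
pose a : R := (eps L)^-1 * d%:R * ln h^-1 * h `^ alpha.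
have a0 : 0 <= a.
  by rewrite mulr_ge0 ?powR_ge0 // mulr_ge0 // mulr_ge0 // invr_ge0 ltW.
have interp0 : 0 <= interp.
  by rewrite divr_ge0 ?exprn_ge0 ?(ltW h0) // mulr_ge0 // exprn_ge0.
(* The three regimes differ only in the rate [T] of the geometric sum: a power of [h], [ln h^-1], or
   1. *)
have bound T : 0 <= T -> S <= Cg * T ->
    30 * B * Ci * (a * S) + 4 * 2 ^+ d * interp <= C * (a * T) + C * interp.
  move=> T0 leS; apply: lerD; last by rewrite ler_wpM2r.
  apply: le_trans (_ : 30 * B * Ci * Cg * (a * T) <= _); last first.
    by rewrite ler_wpM2r // mulr_ge0.
  rewrite -[leRHS]mulrA ler_wpM2l // mulrCA ler_wpM2l //.
have hsum : h `^ alpha * h `^ (nu - d%:R - alpha) = (h `^ (d%:R - nu))^-1.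
  rewrite -powRD ?(gt_eqF h0) ?implybT // -powRN; congr (_ `^ _); ring.
move=> le_cost; split=> [lt_alpha|eq_alpha|gt_alpha];
  apply: (le_trans le_cost); rewrite lee_fin.
- apply: le_trans (bound (h `^ (nu - d%:R - alpha)) _ _) _.
  + exact: powR_ge0.
  + by apply: geo_lt; lra.
  + rewrite le_eqVlt; apply/orP; left; apply/eqP; congr (C * _ + _).
    by rewrite /a -(mulrA _ (h `^ alpha)) hsum; ring.
(* In the critical case the number of levels supplies the second logarithm. *)
- apply: le_trans (bound (ln h^-1) _ _) _ => //.
  + by apply: geo_eq; lra.
  + rewrite le_eqVlt; apply/orP; left; apply/eqP; congr (C * _ + _).
    have -> : d%:R - nu = - alpha by lra.
    by rewrite /a powRN invrK; ring.
- apply: le_trans (bound 1 _ _) _ => //.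
  + by rewrite mulr1; apply: geo_gt; lra.
  + rewrite le_eqVlt; apply/orP; left; apply/eqP; congr (C * _ + _).
    by rewrite /a powRN invrK; ring.
Qed.
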